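(* Let $\lambda>0$, $a>0$, and let $(\gamma_n)_{n\ge0}$ be i.i.d. random variables with law $GIG(\lambda,a,a)$. Then the law of the random variable $$N_\infty^{(\lambda)}=\sum_{k=0}^{+\infty}\gamma_k^{-1}\Big(\prod_{i=0}^{k-1}\gamma_i^{-1}\Big)^2$$ is the inverse-gamma distribution $$d\pi(x)=\frac{a^{2\lambda}}{2^\lambda\Gamma(\lambda)}x^{-\lambda-1}e^{-\frac{a^2}{2x}}\mathbf{1}_{(0,+\infty)}(x)\,dx.$$
   Context: Empty products equal $1$; $\Gamma$ is Euler's gamma function. For $a>0$ and $\lambda\in\mathbb{R}$, $GIG(\lambda,a,a)$ (Generalized Inverse Gaussian) is the probability law on $(0,+\infty)$ with density $x\mapsto \frac{1}{2K_\lambda(a^2)}x^{\lambda-1}e^{-\frac{a^2}{2}(x+\frac1x)}$, where $K_\lambda(z)=\frac12\int_0^{+\infty}x^{\lambda-1}e^{-\frac z2(x+\frac1x)}dx$ for $z>0$ is the Macdonald function. *)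

(* Defs.v *)
From HB Require Import structures.
From mathcomp Require Import all_boot all_order all_algebra.
From mathcomp Require Import finmap.
From mathcomp Require Import all_classical all_reals all_analysis.
From mathcomp Require Import measurable_realfun.

Set Implicit Arguments.
Unset Strict Implicit.
Unset Printing Implicit Defensive.

Import Order.TTheory GRing.Theory Num.Theory.
Import numFieldNormedType.Exports.

Local Open Scope classical_set_scope.
Local Open Scope ring_scope.

Section special_functions.
Context {R : realType}.
Notation mu := (@lebesgue_measure R).

Definition Gamma (s : R) : R :=
  \int[mu]_(x in `]0, +oo[) (x `^ (s - 1) * expR (- x)).

Definition macdonald (lambda z : R) : R :=
  2^-1 * \int[mu]_(x in `]0, +oo[)
           (x `^ (lambda - 1) * expR (- (z / 2) * (x + x^-1))).

End special_functions.

(* Both laws are given as set functions, in the style of [exponential_prob];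
   they are probability measures for [0 < a] (and [0 < lambda] for the second
   one). The densities vanish outside of ]0, +oo[. *)
Section laws.
Context {R : realType}.
Notation mu := (@lebesgue_measure R).
Variables lambda a : R.

Definition gig_pdf : R -> R :=
  (fun x => (2 * macdonald lambda (a ^+ 2))^-1 * x `^ (lambda - 1) *
            expR (- (a ^+ 2 / 2) * (x + x^-1))) \_ `]0, +oo[.

Definition gig_prob (V : set R) : \bar R :=
  (\int[mu]_(x in V) (gig_pdf x)%:E)%E.

Definition inv_gamma_pdf : R -> R :=
  (fun x => a `^ (2 * lambda) / (2 `^ lambda * Gamma lambda) *
            x `^ (- lambda - 1) * expR (- (a ^+ 2 / (2 * x)))) \_ `]0, +oo[.

Definition inv_gamma_prob (V : set R) : \bar R :=
  (\int[mu]_(x in V) (inv_gamma_pdf x)%:E)%E.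

End laws.

Section measurability.
Context {R : realType}.

Lemma measurable_invr : measurable_fun [set: R] (@GRing.inv R).
Proof.
rewrite (_ : GRing.inv = fun x : R => x * ((x ^+ 2) `^ (- 1))); last first.
  apply/funext => x; rewrite powR_inv1 ?sqr_ge0//.
  have [->|x0] := eqVneq x 0; first by rewrite invr0 mul0r.
  by rewrite expr2 invfM mulrA divff// mul1r.
apply: measurable_funM => //.
exact: (measurableT_comp (measurable_powR (-1))).
Qed.

Lemma cvgn_limn_esup_einf (u : R^nat) (eu := EFin \o u) :
  cvgn u <-> limn_esup eu \is a fin_num /\ limn_esup eu = limn_einf eu.
Proof.
split=> [/cvg_ex[l ul]|[fu uE]].
  have /cvg_limn_einf_sup[-> ->] : eu @ \oo --> l%:E.
    by apply: cvg_comp ul _; exact: cvg_id.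
  by [].
apply/cvg_ex; exists (fine (limn_esup eu)).
apply: (@fine_cvg _ _ _ _ eu); rewrite fineK//.
apply: (@squeeze_cvge _ _ _ _ (einfs eu) _ (esups eu)).
- near=> n; apply/andP; split.
    by apply: ereal_inf_lbound; exists n => /=.
  by apply: ereal_sup_ubound; exists n => /=.
- rewrite uE limn_einf_lim; exact: is_cvg_einfs.
- rewrite limn_esup_lim; exact: is_cvg_esups.
Unshelve. all: by end_near. Qed.

(* Pointwise limits are measurable even where the sequence diverges, because
   [limn] is then the constant [point]. *)
Lemma measurable_fun_limn d (T : measurableType d) (h : (T -> R)^nat) :
  (forall n, measurable_fun [set: T] (h n)) ->
  measurable_fun [set: T] (fun w => limn (h ^~ w)).
Proof.
move=> mh.
pose eh n w := (h n w)%:E.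
have meh n : measurable_fun [set: T] (eh n) by exact/measurable_EFinP.
have msup := measurable_fun_limn_esup meh.
have minf : measurable_fun [set: T] (fun w => limn_einf (eh ^~ w)).
  rewrite /limn_einf; apply: measurableT_comp => //.
  apply: (@measurable_fun_limn_esup _ _ _ _ (fun n w => - eh n w)%E) => n.
  exact: measurableT_comp.
pose D := [set w | cvgn (h ^~ w)].
have mD : measurable D.
  rewrite (_ : D = (setT `&` [set w | limn_esup (eh ^~ w) \is a fin_num]) `&`
      (setT `&` [set w | limn_esup (eh ^~ w) = limn_einf (eh ^~ w)])).
    by apply: measurableI; [exact: emeasurable_fin_num|exact: measurable_eqe].
  by rewrite !setTI; apply/seteqP; split => w /cvgn_limn_esup_einf.
rewrite -(setvU D); apply/measurable_funU => //; first exact: measurableC.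
split.
  apply: (eq_measurable_fun (fun=> point)) => // w; rewrite inE /= => nD.
  by apply/esym/dvgP.
by apply: (measurable_fun_cvg (h := h)) => [n|w //]; exact: measurable_funTS.
Qed.

End measurability.

Section random_variables.
Context d (T : measurableType d) {R : realType} (P : probability T R).

Definition mutually_independent d' (T' : measurableType d') (I : choiceType)
    (X : I -> {RV P >-> T'}) : Prop :=
  forall (J : {fset I}) (A : I -> set T'),
    (forall i, i \in J -> measurable (A i)) ->
    (P (\bigcap_(i in [set` J]) (X i @^-1` A i)) =
     \prod_(i <- enum_fset J) P (X i @^-1` A i))%E.

Definition has_law d' (T' : measurableType d') (X : {RV P >-> T'})
    (m : set T' -> \bar R) : Prop :=
  forall A, measurable A -> distribution P X A = m A.

Section perpetuity.
Variable gamma : nat -> {RV P >-> R}.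

Definition perpetuity_term (w : T) (k : nat) : R :=
  (gamma k w)^-1 * (\prod_(i < k) (gamma i w)^-1) ^+ 2.

(* The value is [point] at those [w] where the series diverges. When the
   [gamma k] are only almost surely positive, the convention [0^-1 = 0] matters
   on a null set only. *)
Definition perpetuity (w : T) : R := limn (series (perpetuity_term w)).

Lemma measurable_perpetuity : measurable_fun [set: T] perpetuity.
Proof.
apply: (@measurable_fun_limn _ _ _ (fun n w => series (perpetuity_term w) n)).
move=> n; rewrite /series /=; apply: measurable_sum => k.
have mV i : measurable_fun [set: T] (fun w => (gamma i w)^-1).
  by apply: (measurableT_comp measurable_invr); exact: measurable_funPT.
apply: measurable_funM => //; apply: measurable_funX.
by apply: measurable_prod => i _; exact: mV.
Qed.

HB.instance Definition _ :=
  isMeasurableFun.Build _ _ _ _ perpetuity measurable_perpetuity.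

End perpetuity.
End random_variables.

Arguments mutually_independent {d T R} P {d' T' I} X.
Arguments has_law {d T R} P {d' T'} X m.

(* Main.v *)
(* If gamma has law GIG(lambda,a,a) and X is independent of gamma with the
   inverse-gamma law pi, then 1/gamma + X/gamma^2 has law pi again: this is the
   marginal form of the Matsumoto-Yor property, and after Tonelli it only needs
   affine changes of variables. Hence, writing S_n for the partial sums and
   Q_n for the square of the product of the 1/gamma_i, i < n, the variable
   S_n + Q_n X has law pi for every n. As Q_n X >= 0 and S_n is nondecreasing,
   S_n is bounded in probability, so it converges almost surely, and its limit
   N satisfies P(N <= t) >= pi(]-oo,t]). The terms gamma_n^-1 Q_n then tend to
   0, and since gamma_n is independent of Q_n and identically distributed,
   Q_n tends to 0 in probability, which gives the converse inequality. *)

Require Import Defs.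
From HB Require Import structures.
From mathcomp Require Import all_boot all_order all_algebra.
From mathcomp Require Import finmap.
From mathcomp Require Import all_classical all_reals all_analysis.
From mathcomp Require Import measurable_realfun ring.

Import Order.TTheory GRing.Theory Num.Theory.
Import numFieldNormedType.Exports.

Local Open Scope classical_set_scope.
Local Open Scope ring_scope.

(** * Integration on the real line *)

(** The space [T] need not carry a variable X of law pi independent of the [gamma n]. Hence X never
    appears as a random variable: it is an inner integral against [nu], and the law of S_n + Q_n X
    is tested on nonnegative measurable functions. The mass of the GIG kernel is not computed. Its
    normalized density is the law of a random variable, so it integrates to 1, which makes the
    kernel mass finite and positive. The masses of the gamma and inverse-gamma kernels are then
    controlled by comparison and by the inversion x -> c/x. This inversion is the only substitution
    that is not affine in one variable, and it is itself derived from affine ones by Tonelli. *)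

Section lebesgue_lemmas.
Set Implicit Arguments.
Unset Strict Implicit.
Context {R : realType}.
Notation mu := (@lebesgue_measure R).
Local Open Scope ereal_scope.

Import HBNNSimple.

(** Linearity extends [mE] from sets to simple functions, and monotone convergence to all
    nonnegative functions. The hypothesis [mE] has the shape of [has_law], so laws given as set
    functions can be integrated against. *)
Lemma integral_density (m : {measure set R -> \bar R}) (p : R -> R)
    (f : R -> \bar R) :
  measurable_fun setT p -> (forall x, (0 <= p x)%R) ->
  (forall A, measurable A -> m A = \int[mu]_(x in A) (p x)%:E) ->
  measurable_fun setT f -> (forall x, 0 <= f x) ->
  \int[m]_x f x = \int[mu]_x (f x * (p x)%:E).
Proof.
move=> mp p0 mE mf f0.
pose g := nnsfun_approx measurableT mf.
have gf x : EFin \o g^~ x @ \oo --> f x by exact: cvg_nnsfun_approx.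
have gnd x : nondecreasing_seq (g^~ x).
  by move=> i j ij; exact/lefP/nd_nnsfun_approx.
have mEp : measurable_fun setT (EFin \o p) by exact/measurable_EFinP.
have intg n : \int[m]_x (g n x)%:E = \int[mu]_x ((g n x)%:E * (p x)%:E).
  have mg r : measurable (g n @^-1` [set r]) by exact: measurable_funPTI.
  under [LHS]eq_integral do rewrite fimfunE -fsumEFin//.
  rewrite ge0_integral_fsum//; last 2 first.
  - by move=> y; exact/measurable_EFinP/measurable_funM.
  - by move=> y x _; rewrite nnfun_muleindic_ge0.
  transitivity (\int[mu]_x (\sum_(y \in range (g n))
      (y * \1_(g n @^-1` [set y]) x)%:E * (p x)%:E)); last first.
    apply: eq_integral => x _; rewrite fimfunE -fsumEFin//.
    by rewrite -ge0_mule_fsuml// => y; exact: nnfun_muleindic_ge0.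
  rewrite ge0_integral_fsum//; last 2 first.
  - move=> y; apply: emeasurable_funM => //; apply/measurable_EFinP.
    by apply: measurable_funM => //; exact: (measurable_indic (mg y)).
  - by move=> y x _; rewrite mule_ge0 ?lee_fin//; exact: nnfun_muleindic_ge0.
  apply: eq_fsbigr => r /[!inE] -[t _ rE].
  have r0 : (0 <= r)%R by rewrite -rE.
  rewrite integralZl_indic_nnsfun// integral_indic// setIT.
  under eq_integral do rewrite EFinM -muleA.
  rewrite ge0_integralZl//; last 2 first.
  - apply: emeasurable_funM => //; apply/measurable_EFinP.
    exact: (measurable_indic (mg r)).
  - by move=> x _; rewrite mule_ge0// lee_fin.
  rewrite mE// [in LHS]integral_mkcond; congr (_ * _).
  by apply: eq_integral => x _; rewrite epatch_indic muleC.
have lhs : \int[m]_x (g n x)%:E @[n --> \oo] --> \int[m]_x f x.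
  under [X in _ --> X]eq_integral do rewrite -(cvg_lim _ (gf _))//.
  apply: cvg_monotone_convergence => //.
  - by move=> n; exact/measurable_EFinP.
  - by move=> n x _; rewrite lee_fin.
  - by move=> x _ i j ij; rewrite lee_fin; exact: gnd.
have gpf x : (g n x)%:E * (p x)%:E @[n --> \oo] --> f x * (p x)%:E.
  exact: cvgeZr (gf x).
have rhs : \int[mu]_x ((g n x)%:E * (p x)%:E) @[n --> \oo] -->
    \int[mu]_x (f x * (p x)%:E).
  under [X in _ --> X]eq_integral do rewrite -(cvg_lim _ (gpf _))//.
  apply: cvg_monotone_convergence => //.
  - move=> n; apply: emeasurable_funM => //; apply/measurable_EFinP.
    exact: (measurable_funPT (g n)).
  - by move=> n x _; rewrite mule_ge0// lee_fin.
  - move=> x _ i j ij; rewrite lee_wpmul2r ?lee_fin//; exact: gnd.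
by apply: cvg_unique lhs _ => //; rewrite (funext intg).
Qed.

(** Lebesgue measure and c times its image under [phi] agree on the intervals ]a, b], hence
    everywhere. All later substitutions are built from this one. *)
Lemma ge0_integral_affine (c e : R) (f : R -> \bar R) : (0 < c)%R ->
  measurable_fun setT f -> (forall x, 0 <= f x) ->
  \int[mu]_x f x = c%:E * \int[mu]_x f (c * x + e)%R.
Proof.
move=> c0 mf f0.
pose phi (x : R) : measurableTypeR R := (c * x + e)%R.
have mphi : measurable_fun setT phi.
  by apply: measurable_funD => //; exact: measurable_funM.
have phiE (a b : R) : phi @^-1` `]a, b] =
      `]((a - e) / c)%R, ((b - e) / c)%R]%classic.
  apply/seteqP; split=> x /=; rewrite /phi !in_itv/= ltr_pdivrMr// ler_pdivlMr//;
    by rewrite ltrBlDr lerBrDr mulrC.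
have c0' : (0 <= c)%R by exact: ltW.
pose c' := NngNum c0'.
have muE A : measurable A -> mu A = mscale c' (pushforward mu phi) A.
  apply: lebesgue_measure_unique => _ [[a b]] _ <- /=.
  rewrite /mscale/= /pushforward phiE !lebesgue_measure_itv/= !lte_fin.
  rewrite ltr_pM2r ?invr_gt0// ltrD2r; case: ifPn => _; last by rewrite mule0.
  by rewrite -!EFinD -EFinM; congr EFin; field; rewrite gt_eqF.
rewrite (eq_measure_integral (mscale c' (pushforward mu phi))); last first.
  by move=> A mA _; exact: muE.
rewrite ge0_integral_mscale//; congr (_ * _).
by rewrite ge0_integral_pushforward//.
Qed.

End lebesgue_lemmas.

(** * Kernels on the positive half-line and inversion of dx/x *)

Section kernels.
Set Implicit Arguments.
Unset Strict Implicit.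
Context {R : realType}.
Notation mu := (@lebesgue_measure R).

(** One family for all unnormalized densities: alpha = beta gives the GIG law, alpha = 0 the
    inverse-gamma law, beta = 0 the gamma law. Extension by 0 keeps every integral over the whole
    line, so affine substitutions never move a domain. *)
Definition gig_kernel (s alpha beta x : R) : R :=
  if 0 < x then x `^ s * expR (- (alpha * x + beta / x)) else 0.

Lemma gig_kernel_ge0 s alpha beta x : 0 <= gig_kernel s alpha beta x.
Proof.
by rewrite /gig_kernel; case: ifPn => // _; rewrite mulr_ge0 ?powR_ge0 ?expR_ge0.
Qed.

Lemma gig_kernelE s alpha beta x : 0 < x ->
  gig_kernel s alpha beta x = x `^ s * expR (- (alpha * x + beta / x)).
Proof. by rewrite /gig_kernel => ->. Qed.

Lemma gig_kernel_le0 s alpha beta x : x <= 0 -> gig_kernel s alpha beta x = 0.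
Proof. by rewrite /gig_kernel ltNge => ->. Qed.

Lemma measurable_gig_kernel s alpha beta :
  measurable_fun setT (gig_kernel s alpha beta).
Proof.
apply: measurable_fun_ifT => //; first exact: measurable_fun_ltr.
apply: measurable_funM; first exact: measurable_powR.
apply: measurableT_comp => //; apply: measurableT_comp => //.
apply: measurable_funD; first exact: measurable_funM.
by apply: measurable_funM => //; exact: measurable_invr.
Qed.

(** Density of the Haar measure dx/x of the positive half-line, extended by 0. *)
Definition pos_inv (x : R) : R := if 0 < x then x^-1 else 0.

Lemma pos_inv_ge0 x : 0 <= pos_inv x.
Proof. by rewrite /pos_inv; case: ifPn => // x0; rewrite invr_ge0 ltW. Qed.

Lemma measurable_pos_inv : measurable_fun setT pos_inv.
Proof.
apply: measurable_fun_ifT => //; first exact: measurable_fun_ltr.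
exact: measurable_invr.
Qed.

Local Open Scope ereal_scope.

(* Invariance of the Haar measure dx/x under inversion, deduced from its scale
   invariance by integrating k(c/x) against the indicator of 0 < xt < 1 and
   applying Tonelli's theorem. *)
Lemma integral_haar_inv (c : R) (k : R -> \bar R) : (0 < c)%R ->
  measurable_fun setT k -> (forall x, 0 <= k x) ->
  \int[mu]_x (k (c / x)%R * (pos_inv x)%:E) = \int[mu]_x (k x * (pos_inv x)%:E).
Proof.
move=> c0 mk k0.
pose J (y : R) : \bar R := (\1_(`]0%R, 1%R[%classic : set R) y)%:E.
have mJ : measurable_fun setT J by exact/measurable_EFinP.
have J0 y : 0 <= J y by rewrite lee_fin.
have J_le0 y : (y <= 0)%R -> J y = 0.
  by move=> y0; rewrite /J indicE memNset//= in_itv/= => /andP[]; rewrite ltNge y0.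
have intJ : \int[mu]_y J y = 1.
  rewrite integral_indic// setIT/= lebesgue_measure_itv/= lte_fin ltr01.
  by rewrite oppr0 addr0.
(* From here on, [J] is only a nonnegative measurable function of integral 1 that vanishes on
   nonpositive numbers. *)
clearbody J.
(* Writing 1/x as an integral creates the second variable for Tonelli. *)
have scale_J x : (0 < x)%R -> \int[mu]_y J (x * y)%R = (x^-1)%:E.
  move=> x0; have := ge0_integral_affine 0 x0 mJ J0; rewrite intJ.
  under eq_integral do rewrite addr0.
  move=> h; rewrite -[LHS]mul1e -(mulVf (lt0r_neq0 x0)) EFinM -muleA -h.
  by rewrite mule1.
have swap (F : R * R -> \bar R) : measurable_fun setT F -> (forall z, 0 <= F z) ->
    \int[mu]_x \int[mu]_y F (x, y) = \int[mu]_y \int[mu]_x F (x, y).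
  by move=> mF F0; exact: (fubini_tonelli (m1 := mu) (m2 := mu) F).
pose pos (x : R) : \bar R := (\1_(`]0%R, +oo[%classic : set R) x)%:E.
have mpos : measurable_fun setT pos by exact/measurable_EFinP.
have pos0 y : 0 <= pos y by rewrite lee_fin.
have pos1 y : (0 < y)%R -> pos y = 1.
  by move=> y0; rewrite /pos indicE mem_set//= in_itv/= y0.
have pos_le0 y : (y <= 0)%R -> pos y = 0.
  by move=> y0; rewrite /pos indicE memNset//= in_itv/= andbT; apply/negP; rewrite -leNgt.
clearbody pos.
have mpi : measurable_fun setT (EFin \o pos_inv).
  by apply/measurable_EFinP; exact: measurable_pos_inv.
have pi0 x : 0 <= (pos_inv x)%:E by rewrite lee_fin pos_inv_ge0.
have mk2 : measurable_fun setT (fun z : R * R => k (z.1 / z.2)%R).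
  apply: measurableT_comp => //; apply: measurable_funM => //.
  exact: (measurableT_comp measurable_invr).
have mk1 : measurable_fun setT (fun z : R * R => k (c / z.1)%R).
  apply: measurableT_comp => //; apply: measurable_funM => //.
  exact: (measurableT_comp measurable_invr).
transitivity (\int[mu]_x \int[mu]_t (k (c / x)%R * (pos x * J (x * t)%R))).
  apply: eq_integral => x _.
  rewrite ge0_integralZl//; last 2 first.
  - by apply: emeasurable_funM => //; exact: measurableT_comp.
  - by move=> y _; rewrite mule_ge0.
  congr (_ * _).
  have [x0|x0] := leP x 0%R.
    by rewrite pos_le0// /pos_inv ltNge x0/=; under eq_integral do rewrite mul0e;
      rewrite integral0.
  rewrite pos1// /pos_inv x0; under eq_integral do rewrite mul1e.
  by rewrite scale_J.
rewrite (swap (fun z => k (c / z.1)%R * (pos z.1 * J (z.1 * z.2)%R))); last 2 first.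
- apply: emeasurable_funM => //; apply: emeasurable_funM.
    exact: measurableT_comp.
  by apply: measurableT_comp => //; exact: measurable_funM.
- by move=> z; rewrite !mule_ge0.
(* For fixed t > 0, substitute x = (c/t) s: then c/x = t/s and x t = c s. *)
transitivity (\int[mu]_t \int[mu]_s
    ((c * pos_inv t)%:E * k (t / s)%R * (pos s * J (c * s)%R))).
  apply: eq_integral => t _ /=.
  have [t0|t0] := leP t 0%R.
    rewrite /pos_inv ltNge t0/= !integral0_eq//= => x _.
      by rewrite mulr0 mul0e mul0e.
    have [x0|x0] := leP x 0%R; first by rewrite pos_le0// mul0e mule0.
    by rewrite J_le0 ?mule0// pmulr_rle0.
  rewrite /pos_inv t0.
  have ct0 : (0 < c / t)%R by rewrite divr_gt0.
  rewrite (ge0_integral_affine 0 ct0); last 2 first.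
  - apply: emeasurable_funM.
      apply: measurableT_comp => //; apply: measurable_funM => //.
      exact: measurable_invr.
    apply: emeasurable_funM => //; apply: measurableT_comp => //.
    exact: measurable_funM.
  - by move=> x; rewrite !mule_ge0.
  rewrite -ge0_integralZl//; last 3 first.
  - apply: emeasurable_funM.
      apply: measurableT_comp => //; apply: measurable_funM => //.
      apply: (measurableT_comp measurable_invr).
      by apply: measurable_funD => //; exact: measurable_funM.
    apply: emeasurable_funM => //; apply: measurableT_comp => //.
      by apply: measurable_funD => //; exact: measurable_funM.
    apply: measurable_funM => //.
    by apply: measurable_funD => //; exact: measurable_funM.
  - by move=> x _; rewrite !mule_ge0.
  - by rewrite lee_fin ltW.
  apply: eq_integral => s _; rewrite addr0 -muleA; congr (_ * _).
  have [s0|s0] := leP s 0%R.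
    by rewrite !pos_le0 ?mul0e ?mule0// pmulr_rle0.
  rewrite !pos1//; last by rewrite mulr_gt0.
  have -> : (c / (c / t * s) = t / s)%R by field; rewrite !gt_eqF.
  by have -> : (c / t * s * t = c * s)%R by field; rewrite gt_eqF.
rewrite (swap (fun z => (c * pos_inv z.1)%:E * k (z.1 / z.2)%R *
    (pos z.2 * J (c * z.2)%R))); last 2 first.
- apply: emeasurable_funM; last first.
    apply: emeasurable_funM; first exact: measurableT_comp.
    by apply: measurableT_comp => //; exact: measurable_funM.
  apply: emeasurable_funM => //.
  apply/measurable_EFinP; apply: measurable_funM => //.
  exact: (measurableT_comp measurable_pos_inv).
- move=> z; rewrite !mule_ge0// lee_fin mulr_ge0// ?pos_inv_ge0//; exact: ltW.
(* For fixed s > 0, substitute t = s r: k(t/s) becomes k(r) and dt/t becomes dr/r. The remaining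
   factor c J(c s) has integral 1. *)
transitivity (\int[mu]_s ((c%:E * J (c * s)%R) * \int[mu]_r (k r * (pos_inv r)%:E))).
  apply: eq_integral => s _ /=.
  have [s0|s0] := leP s 0%R.
    rewrite integral0_eq//; last by move=> x _; rewrite pos_le0// mul0e mule0.
    by rewrite J_le0 ?mule0 ?mul0e// pmulr_rle0.
  rewrite (ge0_integral_affine 0 s0); last 2 first.
  - apply: emeasurable_funM => //; apply: emeasurable_funM.
      by apply/measurable_EFinP; apply: measurable_funM => //; exact: measurable_pos_inv.
    by apply: measurableT_comp => //; exact: measurable_funM.
  - move=> x; rewrite !mule_ge0// lee_fin mulr_ge0// ?pos_inv_ge0//; exact: ltW.
  rewrite -!ge0_integralZl//; last 6 first.
  - exact: emeasurable_funM.
  - by move=> x _; rewrite mule_ge0.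
  - by rewrite mule_ge0// lee_fin ltW.
  - apply: emeasurable_funM => //; apply: emeasurable_funM.
      apply/measurable_EFinP; apply: measurable_funM => //.
      apply: (measurableT_comp measurable_pos_inv).
      by apply: measurable_funD => //; exact: measurable_funM.
    apply: measurableT_comp => //; apply: measurable_funM => //.
    by apply: measurable_funD => //; exact: measurable_funM.
  - move=> x _; rewrite !mule_ge0// lee_fin mulr_ge0// ?pos_inv_ge0//; exact: ltW.
  - by rewrite lee_fin ltW.
  apply: eq_integral => r _; rewrite addr0 pos1// mul1e.
  rewrite (_ : (s * r / s = r)%R); last by field; rewrite gt_eqF.
  rewrite !muleA -EFinM muleAC [RHS]muleAC; congr (_ * _).
  rewrite muleAC -EFinM; congr (_%:E * _).
  rewrite /pos_inv pmulr_rgt0//; case: ifPn => r0; last by rewrite !mulr0.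
  by field; rewrite !gt_eqF.
rewrite ge0_integralZr//; last 3 first.
- by apply: emeasurable_funM => //; exact: measurableT_comp.
- by move=> x _; rewrite mule_ge0// lee_fin ltW.
- by apply: integral_ge0 => x _; rewrite mule_ge0.
rewrite ge0_integralZl//; last 2 first.
- exact: measurableT_comp.
- by rewrite lee_fin ltW.
by rewrite scale_J// -EFinM divff ?gt_eqF// mul1e.
Qed.

End kernels.

(** * Invariance of the inverse-gamma law *)

Section kernel_integrals.
Set Implicit Arguments.
Unset Strict Implicit.
Context {R : realType}.
Notation mu := (@lebesgue_measure R).

Lemma gt0_powRD (x r s : R) : 0 < x -> x `^ (r + s) = x `^ r * x `^ s.
Proof. by move=> x0; rewrite powRD// [in X in _ ==> X]gt_eqF// implybT. Qed.

Local Open Scope ereal_scope.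

Let mkernel s alpha beta :
  measurable_fun setT (EFin \o @gig_kernel R s alpha beta).
Proof. by apply/measurable_EFinP; exact: measurable_gig_kernel. Qed.

(** Since x^s dx = x^(s+1) dx/x, the substitution x -> c/x exchanges alpha and beta up to powers of
    c. The case c = 1 contains the symmetry of the Macdonald function in its index; c = b relates
    the gamma integral to the inverse-gamma kernel. *)
Lemma integral_gig_kernel_inv (c s alpha beta : R) : (0 < c)%R ->
  \int[mu]_x (gig_kernel s alpha beta x)%:E =
  (c `^ (s + 1))%:E *
  \int[mu]_x (gig_kernel (- s - 2) (beta / c) (c * alpha) x)%:E.
Proof.
move=> c0; pose k (x : R) : \bar R := (gig_kernel (s + 1) alpha beta x)%:E.
have mk : measurable_fun setT k by exact: mkernel.
have k0 x : 0 <= k x by rewrite lee_fin gig_kernel_ge0.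
transitivity (\int[mu]_x (k x * (pos_inv x)%:E)).
  apply: eq_integral => x _; rewrite /k -EFinM; congr EFin.
  rewrite /pos_inv /gig_kernel; case: ifPn => x0; last by rewrite mulr0.
  rewrite gt0_powRD// powRr1 ?ltW//.
  by rewrite -!mulrA; congr *%R; field; rewrite gt_eqF.
rewrite -(integral_haar_inv c0 mk k0) -ge0_integralZl//; last 3 first.
- exact: mkernel.
- by move=> x _; rewrite lee_fin gig_kernel_ge0.
- by rewrite lee_fin powR_ge0.
apply: eq_integral => x _; rewrite /k -!EFinM; congr EFin.
rewrite /pos_inv /gig_kernel; have [x0|x0] := ltP 0%R x; last by rewrite !mulr0.
rewrite divr_gt0// powRM ?invr_ge0 ?ltW// -powR_inv1 ?ltW// -powRrM.
rewrite mulrAC -!mulrA; congr *%R; rewrite mulrA -gt0_powRD//.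
congr (_ `^ _ * expR (- _))%R; first by ring.
by rewrite powR_inv1 ?ltW//; field; rewrite !gt_eqF.
Qed.

(* The Jacobian identity behind the Matsumoto-Yor property: x = g^2 z - g solves
   z = 1/g + x/g^2, and g = h + 1/z. *)
Lemma gig_kernel_subst (lambda b z h : R) (g := (h + z^-1)%R) : (0 < z)%R ->
  (g ^+ 2 * (gig_kernel (- lambda - 1) 0 b (g ^+ 2 * z - g) *
             gig_kernel (lambda - 1) b b g) =
   gig_kernel (- lambda - 1) 0 b z * gig_kernel (- lambda - 1) b b h)%R.
Proof.
move=> z0; have gE : (g ^+ 2 * z - g = g * (h * z))%R.
  by rewrite /g; field; rewrite gt_eqF.
have [h0|h0] := leP h 0%R.
  rewrite (gig_kernel_le0 _ _ _ h0) mulr0.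
  have [g0|g0] := leP g 0%R; first by rewrite (gig_kernel_le0 _ _ _ g0) !mulr0.
  rewrite (@gig_kernel_le0 _ (- lambda - 1)) ?mul0r ?mulr0// gE.
  by rewrite pmulr_rle0// pmulr_lle0.
have g0 : (0 < g)%R by rewrite addr_gt0 ?invr_gt0.
rewrite gE !gig_kernelE ?mulr_gt0//.
rewrite !powRM ?mulr_ge0 ?ltW// [X in (_ * X)%R = _]mulrACA [RHS]mulrACA -!expRD.
(* The two powers of g multiply to g^-2, which cancels the Jacobian g^2. *)
have -> : (g `^ (- lambda - 1) * (h `^ (- lambda - 1) * z `^ (- lambda - 1)) *
  g `^ (lambda - 1) = z `^ (- lambda - 1) * h `^ (- lambda - 1) * g ^- 2)%R.
  rewrite -powR_invn ?ltW//.
  have -> : (- 2%:R = (- lambda - 1) + (lambda - 1) :> R)%R by ring.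
  by rewrite (@gt0_powRD g (- lambda - 1) (lambda - 1) g0); ring.
rewrite [LHS]mulrA; congr (_ * expR _)%R.
  by rewrite mulrC divfK// expf_neq0// gt_eqF.
(* The exponents agree because 1/(g h z) + 1/g = 1/h and g = h + 1/z. *)
have hz0 : (0 < h * z)%R by rewrite mulr_gt0.
have : (h * z + 1 != 0)%R by rewrite gt_eqF// addr_gt0.
rewrite /g => hz1; field.
by rewrite hz1 !gt_eqF.
Qed.

(** Substitute x = g^2 z - g for fixed g, exchange the integrals, then translate g = h + 1/z for
    fixed z. The integrand factors: z keeps the inverse-gamma kernel and h, with the GIG kernel of
    index -lambda, integrates out. *)
Lemma gig_kernel_perpetuity (lambda b : R) (f : R -> \bar R) :
  measurable_fun setT f -> (forall x, 0 <= f x) ->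
  \int[mu]_g \int[mu]_x (f (g^-1 + g^-1 ^+ 2 * x)%R *
    (gig_kernel (- lambda - 1) 0 b x * gig_kernel (lambda - 1) b b g)%:E) =
  \int[mu]_h (gig_kernel (- lambda - 1) b b h)%:E *
  \int[mu]_z (f z * (gig_kernel (- lambda - 1) 0 b z)%:E).
Proof.
move=> mf f0.
pose v := gig_kernel (- lambda - 1) 0 b; pose u := gig_kernel (lambda - 1) b b.
have mv : measurable_fun setT v by exact: measurable_gig_kernel.
have meas_u : measurable_fun setT u by exact: measurable_gig_kernel.
have v0 x : (0 <= v x)%R by exact: gig_kernel_ge0.
have u0 x : (0 <= u x)%R by exact: gig_kernel_ge0.
pose F (t : R * R) : \bar R :=
  f t.2 * (t.1 ^+ 2 * (v (t.1 ^+ 2 * t.2 - t.1) * u t.1))%:E.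
have mF : measurable_fun setT F.
  apply: emeasurable_funM; first exact: measurableT_comp.
  apply/measurable_EFinP; apply: measurable_funM; first exact: measurable_funX.
  apply: measurable_funM; last exact: measurableT_comp.
  apply: (measurableT_comp mv); apply: measurable_funB => //.
  by apply: measurable_funM => //; exact: measurable_funX.
have F0 t : 0 <= F t by rewrite mule_ge0// lee_fin mulr_ge0 ?sqr_ge0// mulr_ge0.
transitivity (\int[mu]_g \int[mu]_z F (g, z)).
  apply: eq_integral => g _; rewrite /F/=.
  have [g0|g0] := leP g 0%R.
    by rewrite !integral0_eq// => x _; rewrite /u (gig_kernel_le0 _ _ _ g0)
      !mulr0 mule0.
  have g20 : (0 < g ^+ 2)%R by rewrite exprn_gt0.
  rewrite (ge0_integral_affine (- g) g20); last 2 first.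
  - apply: emeasurable_funM.
      apply: measurableT_comp => //; apply: measurable_funD => //.
    by apply/measurable_EFinP; exact: measurable_funM.
  - by move=> x; rewrite mule_ge0// lee_fin mulr_ge0.
  rewrite -ge0_integralZl//; last 3 first.
  - apply: emeasurable_funM.
      apply: measurableT_comp => //; apply: measurable_funD => //.
      by apply: measurable_funM => //; exact: measurable_funD.
    apply/measurable_EFinP; apply: measurable_funM => //.
    by apply: (measurableT_comp mv); exact: measurable_funD.
  - by move=> x _; rewrite mule_ge0// lee_fin mulr_ge0.
  - by rewrite lee_fin ltW.
  apply: eq_integral => z _.
  have -> : (g^-1 + g^-1 ^+ 2 * (g ^+ 2 * z - g) = z)%R.
    by field; rewrite gt_eqF.
  by rewrite muleCA -EFinM.
have := @fubini_tonelli _ _ _ _ _ mu mu F mF F0 => ->.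
rewrite -ge0_integralZl//; last 3 first.
- by apply: emeasurable_funM => //; exact/measurable_EFinP.
- by move=> z _; rewrite mule_ge0// lee_fin.
- by apply: integral_ge0 => x _; rewrite lee_fin gig_kernel_ge0.
apply: eq_integral => z _; rewrite /F/=.
have [z0|z0] := leP z 0%R.
  rewrite [in RHS](gig_kernel_le0 _ _ _ z0) mule0 mule0.
  rewrite integral0_eq// => g _.
  have [g0|g0] := leP g 0%R.
    by rewrite /u (gig_kernel_le0 _ _ _ g0) !mulr0 mule0.
  rewrite /v gig_kernel_le0 ?mul0r ?mulr0 ?mule0//.
  rewrite subr_le0 (le_trans _ (ltW g0))//.
  by rewrite mulr_ge0_le0// sqr_ge0.
rewrite (@ge0_integral_affine _ 1 z^-1)//; last 2 first.
- have mFz : measurable_fun setT (fun g => F (g, z)).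
    by apply: (measurableT_comp mF); exact: measurable_fun_pair.
  exact: mFz.
- by move=> g; exact: (F0 (g, z)).
rewrite mul1e muleC -ge0_integralZl//; last 3 first.
- exact: mkernel.
- by move=> x _; rewrite lee_fin gig_kernel_ge0.
- by rewrite mule_ge0// lee_fin.
apply: eq_integral => h _; rewrite mul1r -muleA -EFinM; congr (_ * _%:E).
exact: gig_kernel_subst.
Qed.

End kernel_integrals.

(** * Normalizing constants and the invariance identity *)

Section invariance.
Set Implicit Arguments.
Unset Strict Implicit.
Context {R : realType}.
Notation mu := (@lebesgue_measure R).
Variables lambda a : R.
Hypotheses (lambda0 : 0 < lambda) (a0 : 0 < a).
Let b := a ^+ 2 / 2.
Let b0 : 0 < b. Proof. by rewrite divr_gt0// exprn_gt0. Qed.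

Lemma gig_pdfE x : gig_pdf lambda a x =
  (2 * macdonald lambda (a ^+ 2))^-1 * gig_kernel (lambda - 1) b b x.
Proof.
rewrite /gig_pdf patchE /gig_kernel mem_setE in_itv/= andbT.
case: ifPn => _; last by rewrite mulr0.
by rewrite -mulrA -/b mulNr mulrDr.
Qed.

Lemma inv_gamma_pdfE x : inv_gamma_pdf lambda a x =
  a `^ (2 * lambda) / (2 `^ lambda * Gamma lambda) *
  gig_kernel (- lambda - 1) 0 b x.
Proof.
rewrite /inv_gamma_pdf patchE /gig_kernel mem_setE in_itv/= andbT.
case: ifPn => x0; last by rewrite mulr0.
rewrite -mulrA mul0r add0r; congr (_ * (_ * expR (- _))).
by rewrite /b; field; rewrite gt_eqF.
Qed.

Lemma macdonald_ge0 z : 0 <= macdonald lambda z.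
Proof.
rewrite mulr_ge0 ?invr_ge0// Rintegral_ge0// => x _.
by rewrite mulr_ge0 ?powR_ge0 ?expR_ge0.
Qed.

Lemma GammaE : Gamma lambda = fine (\int[mu]_x (gig_kernel (lambda - 1) 1 0 x)%:E).
Proof.
rewrite /Gamma /Rintegral integral_mkcond; congr fine; apply: eq_integral => x _.
rewrite patchE /gig_kernel mem_setE in_itv/= andbT; case: ifPn => // _.
by rewrite mul1r mul0r addr0.
Qed.

Lemma Gamma_ge0 : 0 <= Gamma lambda.
Proof.
rewrite /Gamma Rintegral_ge0// => x _.
by rewrite mulr_ge0 ?powR_ge0 ?expR_ge0.
Qed.

Lemma gig_pdf_ge0 x : 0 <= gig_pdf lambda a x.
Proof.
by rewrite gig_pdfE mulr_ge0 ?gig_kernel_ge0// invr_ge0 mulr_ge0// macdonald_ge0.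
Qed.

Lemma inv_gamma_pdf_ge0 x : 0 <= inv_gamma_pdf lambda a x.
Proof.
rewrite inv_gamma_pdfE mulr_ge0 ?gig_kernel_ge0//.
by rewrite divr_ge0 ?powR_ge0// mulr_ge0 ?powR_ge0// Gamma_ge0.
Qed.

Lemma measurable_gig_pdf : measurable_fun setT (gig_pdf lambda a).
Proof.
rewrite (funext gig_pdfE); apply: measurable_funM => //.
exact: measurable_gig_kernel.
Qed.

Lemma measurable_inv_gamma_pdf : measurable_fun setT (inv_gamma_pdf lambda a).
Proof.
rewrite (funext inv_gamma_pdfE); apply: measurable_funM => //.
exact: measurable_gig_kernel.
Qed.

Local Open Scope ereal_scope.

Local Notation I s alpha beta := (\int[mu]_x (gig_kernel s alpha beta x)%:E).

Let mkernel s alpha beta :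
  measurable_fun setT (EFin \o @gig_kernel R s alpha beta).
Proof. by apply/measurable_EFinP; exact: measurable_gig_kernel. Qed.

(** Positivity of [lambda] enters here: it makes the antiderivative -x^(-lambda)/lambda vanish at
    infinity. *)
Lemma integral_powR_tail : \int[mu]_(x in `[1%R, +oo[) (x `^ (- lambda - 1))%:E =
  (lambda^-1)%:E.
Proof.
pose F (x : R) : R := (- (lambda^-1 * x `^ (- lambda)))%R.
have dpow s (x : R) : (0 < x)%R -> derivable (fun y : R => y `^ s)%R x 1.
  by move=> x0; apply: derivable_powR; rewrite in_itv/= x0.
have cpow s (x : R) : (0 < x)%R -> {for x, continuous (fun y : R => y `^ s)%R}.
  by move=> x0; exact/differentiable_continuous/derivable1_diffP/dpow.
have dF x : (0 < x)%R -> derivable F x 1.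
  by move=> x0; apply: derivableN; apply: derivableM => //; exact: dpow.
rewrite (@ge0_continuous_FTC2y _ _ F _ 0%R).
- by rewrite /F powR1 mulr1 sub0e -EFinN opprK.
- by move=> x _; exact: powR_ge0.
- apply/continuous_within_itvcyP; split.
    move=> x; rewrite in_itv/= andbT => x1; apply: cpow.
    exact: lt_trans x1.
  by apply: cvg_at_right_filter; apply: cpow.
- rewrite -oppr0; apply: cvgN; rewrite -(mulr0 (lambda^-1)%R).
  apply: cvgM; first exact: cvg_cst.
  apply/cvgrPdist_lt => e e0; near=> x.
  have x0 : (0 < x)%R by near: x; exact: nbhs_pinfty_gt.
  rewrite sub0r normrN ger0_norm ?powR_ge0// powRN -[ltRHS]invrK.
  rewrite ltf_pV2 ?posrE ?powR_gt0 ?invr_gt0//.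
  have e1 : (0 <= e^-1)%R by rewrite invr_ge0 ltW.
  (* It is enough that x exceeds (1/e)^(1/lambda), which holds eventually. *)
  rewrite -[ltLHS]powRr1// -(mulVf (lt0r_neq0 lambda0)) powRrM.
  by apply: gt0_ltr_powR; rewrite ?nnegrE ?powR_ge0 ?ltW//; near: x;
    exact: nbhs_pinfty_gt.
- by move=> x x1; apply: dF; exact: lt_trans x1.
- apply: cvg_at_right_filter.
  exact/differentiable_continuous/derivable1_diffP/dF.
- move=> x; rewrite in_itv/= andbT => x1.
  have x0 : (0 < x)%R by exact: lt_trans x1.
  rewrite /F derive1E deriveN; last first.
    by apply: derivableM => //; exact: dpow.
  rewrite deriveZ; last exact: dpow.
  rewrite -derive1E powR_derive1 ?in_itv/= ?x0//.
  rewrite /GRing.scale/= -mulNr mulrA; have -> : (- lambda^-1 * - lambda = 1)%R.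
    by rewrite mulrNN mulVf// gt_eqF.
  by rewrite mul1r.
Unshelve. all: by end_near. Qed.

(** Dropping e^(-b x) costs at most a factor e^b on ]0, 1[, where b x <= b; on [1, +oo[ the bare
    power dominates. Thus the GIG mass controls the inverse-gamma mass near 0, and the power tail
    controls it at infinity. *)
Lemma gig_kernel_le_tail x : ((gig_kernel (- lambda - 1) 0 b x)%:E <=
  (expR b)%:E * (gig_kernel (- lambda - 1) b b x)%:E +
  ((fun x => (x `^ (- lambda - 1))%:E : \bar R) \_ `[1%R, +oo[) x).
Proof.
rewrite patchE mem_setE in_itv/= andbT.
have [x0|x0] := leP x 0%R.
  rewrite (gig_kernel_le0 _ _ _ x0); apply: adde_ge0.
    by rewrite mule_ge0// lee_fin ?expR_ge0 ?gig_kernel_ge0.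
  by case: ifPn => // _; rewrite lee_fin powR_ge0.
rewrite !gig_kernelE//; have [x1|x1] := leP 1%R x.
  rewrite -EFinM -EFinD lee_fin -[leLHS]add0r lerD//.
    by rewrite !mulr_ge0 ?expR_ge0 ?powR_ge0.
  rewrite ler_piMr ?powR_ge0// -expR0 ler_expR mul0r add0r oppr_le0.
  by rewrite divr_ge0 ?ltW.
rewrite adde0 -EFinM lee_fin mulrCA ler_wpM2l ?powR_ge0// -expRD ler_expR.
by rewrite mul0r add0r opprD addrA lerDr subr_ge0 ler_piMr ?ltW.
Qed.

Lemma gig_kernel_le_beta0 s beta x : (0 <= beta)%R ->
  (gig_kernel s b beta x <= gig_kernel s b 0 x)%R.
Proof.
move=> beta0; rewrite /gig_kernel; case: ifPn => // x0.
rewrite ler_wpM2l ?powR_ge0// ler_expR lerN2 lerD2l mul0r.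
by rewrite divr_ge0// ltW.
Qed.

Lemma integral_gig_kernel_lty :
  I (- lambda - 1) b b < +oo -> I (- lambda - 1) 0 b < +oo.
Proof.
move=> Ih_lty; pose t x := ((x `^ (- lambda - 1))%:E : \bar R).
pose tail := t \_ `[1%R, +oo[.
have mt : measurable_fun setT t.
  by apply/measurable_EFinP; exact: measurable_powR.
have mtail : measurable_fun setT tail.
  by apply/(measurable_restrictT _ _).1 => //; exact: measurable_funTS.
have tail0 x : 0 <= tail x.
  by rewrite /tail patchE; case: ifPn => // _; rewrite lee_fin powR_ge0.
apply: (@le_lt_trans _ _ (\int[mu]_x
    ((expR b)%:E * (gig_kernel (- lambda - 1) b b x)%:E + tail x))).
  apply: ge0_le_integral => //.
  - by move=> x _; rewrite lee_fin gig_kernel_ge0.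
  - exact: mkernel.
  - apply: emeasurable_funD => //; apply: emeasurable_funM => //; exact: mkernel.
  by move=> x _; exact: gig_kernel_le_tail.
rewrite ge0_integralD//; last 2 first.
- by move=> x _; rewrite mule_ge0// lee_fin ?expR_ge0 ?gig_kernel_ge0.
- by apply: emeasurable_funM => //; exact: mkernel.
rewrite ge0_integralZl//; last 2 first.
- exact: mkernel.
- by move=> x _; rewrite lee_fin gig_kernel_ge0.
rewrite -integral_mkcond integral_powR_tail lte_add_pinfty ?ltry//.
by rewrite lte_mul_pinfty ?lee_fin ?expR_ge0//.
Qed.

Section normalization.
(** The law of [gamma 0] will supply this. A nonnegative real constant times the kernel mass is then
    1, so this mass is neither 0 nor infinite, although [macdonald] would take the default value 0
    for a divergent integral. *)
Hypothesis gig_mass : \int[mu]_x (gig_pdf lambda a x)%:E = 1.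

Lemma gig_massE :
  ((2 * macdonald lambda (a ^+ 2))^-1)%:E * I (lambda - 1) b b = 1.
Proof.
rewrite -gig_mass -ge0_integralZl//.
- by apply: eq_integral => x _; rewrite gig_pdfE EFinM.
- exact: mkernel.
- by move=> x _; rewrite lee_fin gig_kernel_ge0.
- by rewrite lee_fin invr_ge0 mulr_ge0// macdonald_ge0.
Qed.

Lemma kernel_mass_ge0 s alpha beta : 0 <= I s alpha beta.
Proof. by apply: integral_ge0 => x _; rewrite lee_fin gig_kernel_ge0. Qed.

Lemma gig_mass_gt0 : 0 < I (lambda - 1) b b.
Proof.
rewrite lt0e kernel_mass_ge0 andbT; apply/eqP => Iu0.
by move: gig_massE; rewrite Iu0 mule0 => /esym/eqP; rewrite onee_eq0.
Qed.

Lemma gig_mass_lty : I (lambda - 1) b b < +oo.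
Proof.
rewrite ltey; apply/eqP => Iuy; move: gig_massE; rewrite Iuy.
set c := (_^-1)%R; have : (0 <= c)%R.
  by rewrite invr_ge0 mulr_ge0// macdonald_ge0.
rewrite le_eqVlt => /predU1P[<-|c0].
  by rewrite mul0e => /esym/eqP; rewrite onee_eq0.
by rewrite gt0_muley ?lte_fin.
Qed.

Lemma gig_mass_opp : I (- lambda - 1) b b = I (lambda - 1) b b.
Proof.
rewrite [RHS](integral_gig_kernel_inv _ _ _ ltr01) powR1 mul1e divr1 mul1r.
by have -> : (- (lambda - 1) - 2 = - lambda - 1)%R by ring.
Qed.

Lemma gamma_mass_inv : I (lambda - 1) b 0 = I (- lambda - 1) 0 b.
Proof.
rewrite [LHS](integral_gig_kernel_inv _ _ _ ltr01) powR1 mul1e mul0r mul1r.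
by have -> : (- (lambda - 1) - 2 = - lambda - 1)%R by ring.
Qed.

Lemma Gamma_mass : I (lambda - 1) 1 0 = (b `^ lambda)%:E * I (- lambda - 1) 0 b.
Proof.
rewrite [LHS](integral_gig_kernel_inv _ _ _ b0) mul0r mulr1 subrK.
by have -> : (- (lambda - 1) - 2 = - lambda - 1)%R by ring.
Qed.

(** After inversion this is the mass of x^(lambda-1) e^(-b x), which dominates the GIG kernel
    pointwise. *)
Lemma inv_gamma_mass_gt0 : 0 < I (- lambda - 1) 0 b.
Proof.
rewrite -gamma_mass_inv; apply: lt_le_trans gig_mass_gt0 _.
apply: ge0_le_integral.
- exact: measurableT.
- by move=> x _; rewrite lee_fin gig_kernel_ge0.
- exact: mkernel.
- exact: mkernel.
- by move=> x _; rewrite lee_fin gig_kernel_le_beta0// ltW.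
Qed.

Lemma inv_gamma_mass_lty : I (- lambda - 1) 0 b < +oo.
Proof. by apply: integral_gig_kernel_lty; rewrite gig_mass_opp gig_mass_lty. Qed.

Lemma integral_inv_gamma_pdf : \int[mu]_x (inv_gamma_pdf lambda a x)%:E = 1.
Proof.
under eq_integral do rewrite inv_gamma_pdfE EFinM.
have Ivfin : I (- lambda - 1) 0 b \is a fin_num.
  by rewrite ge0_fin_numE ?inv_gamma_mass_lty ?kernel_mass_ge0.
rewrite ge0_integralZl//; last 3 first.
- exact: mkernel.
- by move=> x _; rewrite lee_fin gig_kernel_ge0.
- by rewrite lee_fin divr_ge0 ?powR_ge0// mulr_ge0 ?powR_ge0// Gamma_ge0.
(* Gamma(lambda) is b^lambda times the kernel mass, and a^(2 lambda) = 2^lambda b^lambda because b =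
   a^2/2. *)
rewrite GammaE [X in fine X]Gamma_mass -[X in _ * X]/(I (- lambda - 1) 0 b).
rewrite -(fineK Ivfin) -EFinM/=; congr EFin.
have Iv0 : (0 < fine (I (- lambda - 1) 0 b))%R.
  by rewrite fine_gt0// inv_gamma_mass_gt0 inv_gamma_mass_lty.
have -> : (a `^ (2 * lambda) = 2 `^ lambda * b `^ lambda)%R.
  rewrite -powRM ?ltW// powRrM powR_mulrn ?ltW//; congr (_ `^ _)%R.
  by rewrite /b; field.
by field; rewrite !gt_eqF ?powR_gt0.
Qed.

Lemma inv_gamma_invariant (f : R -> \bar R) :
  measurable_fun setT f -> (forall x, 0 <= f x) ->
  \int[mu]_g (\int[mu]_x (f (g^-1 + g^-1 ^+ 2 * x)%R *
      (inv_gamma_pdf lambda a x)%:E) * (gig_pdf lambda a g)%:E) =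
  \int[mu]_z (f z * (inv_gamma_pdf lambda a z)%:E).
Proof.
move=> mf f0.
set c := (2 * macdonald lambda (a ^+ 2))^-1%R.
set d := (a `^ (2 * lambda) / (2 `^ lambda * Gamma lambda))%R.
have c0 : (0 <= c)%R by rewrite invr_ge0 mulr_ge0// macdonald_ge0.
have d0 : (0 <= d)%R.
  by rewrite divr_ge0 ?powR_ge0// mulr_ge0 ?powR_ge0// Gamma_ge0.
pose v := gig_kernel (- lambda - 1) 0 b; pose u := gig_kernel (lambda - 1) b b.
have mv : measurable_fun setT v by exact: measurable_gig_kernel.
have meas_u : measurable_fun setT u by exact: measurable_gig_kernel.
have v0 x : (0 <= v x)%R by exact: gig_kernel_ge0.
have u0 x : (0 <= u x)%R by exact: gig_kernel_ge0.
have mEv : measurable_fun setT (EFin \o v) by exact/measurable_EFinP.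
pose F (t : R * R) : \bar R :=
  f (t.1^-1 + t.1^-1 ^+ 2 * t.2)%R * (v t.2 * u t.1)%:E.
have mF : measurable_fun setT F.
  have mV : measurable_fun setT (fun t : R * R => t.1^-1%R).
    exact: (measurableT_comp measurable_invr).
  apply: emeasurable_funM.
    apply: measurableT_comp => //; apply: measurable_funD => //.
    by apply: measurable_funM => //; exact: measurable_funX.
  by apply/measurable_EFinP; apply: measurable_funM; exact: measurableT_comp.
have F0 t : 0 <= F t by rewrite mule_ge0// lee_fin mulr_ge0.
have mfg (g : R) : measurable_fun setT (fun x => f (g^-1 + g^-1 ^+ 2 * x)%R).
  apply: measurableT_comp => //; apply: measurable_funD => //.
have mfv (g : R) : measurable_fun setT
    (fun x => f (g^-1 + g^-1 ^+ 2 * x)%R * (v x)%:E).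
  by apply: emeasurable_funM; [exact: mfg|exact: mEv].
transitivity (\int[mu]_g ((c * d)%:E * \int[mu]_x F (g, x))).
  apply: eq_integral => g _; rewrite gig_pdfE -/c -/u.
  under eq_integral do rewrite inv_gamma_pdfE -/d -/v EFinM muleCA.
  rewrite ge0_integralZl//; last 2 first.
  - exact: mfv.
  - by move=> x _; rewrite mule_ge0// lee_fin.
  under [in RHS]eq_integral do rewrite /F/= EFinM muleA.
  rewrite [in RHS]ge0_integralZr//; last 3 first.
  - exact: mfv.
  - by move=> x _; rewrite mule_ge0// lee_fin.
  - by rewrite lee_fin.
  by rewrite !EFinM muleACA (muleC d%:E c%:E) -!muleA; congr (_ * _); rewrite muleCA.
rewrite ge0_integralZl//; last 3 first.
- exact: measurable_fun_fubini_tonelli_F.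
- by move=> g _; apply: integral_ge0.
- by rewrite lee_fin mulr_ge0.
rewrite [X in _ * X](gig_kernel_perpetuity lambda b mf f0).
rewrite muleA [(c * d)%R]mulrC EFinM -[X in X * _ = _]muleA.
(* The integral over h is the GIG mass of index -lambda; by symmetry in the index, the constant [c]
   normalizes it too. *)
rewrite [X in _ * X * _ = _](_ : _ = 1) ?mule1;
  last by rewrite -gig_massE -gig_mass_opp.
rewrite -ge0_integralZl//.
- by apply: eq_integral => z _; rewrite inv_gamma_pdfE EFinM muleCA.
- by apply: emeasurable_funM; [exact: mf|exact: mEv].
- by move=> x _; rewrite mule_ge0// lee_fin.
Qed.

End normalization.
End invariance.

(** * Independence of the past *)

Section independence.
Set Implicit Arguments.
Unset Strict Implicit.
Context d (T : measurableType d) {R : realType} (P : probability T R).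
Context d' (T' : measurableType d') (X : nat -> {RV P >-> T'}).

(** A pi-system of cylinder events that generates the sigma-algebra of X_0, ..., X_(n-1). *)
Definition past (n : nat) : set (set T) :=
  [set \bigcap_(i in `I_n) X i @^-1` A i | A in
    [set A : nat -> set T' | forall i, measurable (A i)]].

Lemma past_measurable n : past n `<=` measurable.
Proof.
move=> _ [A mA <-]; apply: bigcap_measurableType => i _.
exact: measurable_funPTI.
Qed.

Lemma past_setI n : setI_closed (past n).
Proof.
move=> _ _ [A mA <-] [B mB <-]; exists (fun i => A i `&` B i).
  by move=> i; exact: measurableI.
apply/seteqP; split=> [w h|w [hA hB] i /= ni].
  by split=> i ni; have [] := h i ni.
by split; [exact: hA|exact: hB].
Qed.

Lemma measurable_past n i : (i < n)%N ->
  measurable_fun setT (X i : g_sigma_algebraType (past n) -> T').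
Proof.
move=> ni _ B mB; rewrite setTI; apply: sub_sigma_algebra.
exists (fun j => if j == i then B else setT); first by move=> j; case: ifP.
apply/seteqP; split=> [w /(_ i ni)|w Bw j /= _]; first by rewrite /= eqxx.
by case: eqP => // ->.
Qed.

Hypothesis indep : mutually_independent P X.

Local Open Scope ereal_scope.

(** Dynkin's argument: for fixed B, the events that factorize form a lambda-system containing the
    pi-system [past n]. *)
Lemma independent_past n (A : set T) (B : set T') :
  <<s past n >> A -> measurable B ->
  P (A `&` X n @^-1` B) = P A * P (X n @^-1` B).
Proof.
move=> sA mB; have mXB : measurable (X n @^-1` B) by exact: measurable_funPTI.
pose H := [set A | measurable A /\ P (A `&` X n @^-1` B) = P A * P (X n @^-1` B)].
suff : <<s past n >> `<=` H by move=> /(_ _ sA) [].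
have finP (C : set T) : measurable C -> P C \is a fin_num.
  by move=> mC; exact: fin_num_measure.
apply: lambda_system_subset; first exact: past_setI; last by [].
- split=> [//| |E F FE [mE HE] [mF HF]|F ndF HF].
  + by split => //; rewrite setTI probability_setT mul1e.
  + split; first exact: measurableD.
    have -> : (E `\` F) `&` X n @^-1` B =
        (E `&` X n @^-1` B) `\` (F `&` X n @^-1` B).
      apply/seteqP; split=> w; first by move=> [[Ew Fw] Bw]; split=> // -[].
      by move=> [[Ew Bw] FBw]; split=> //; split=> // Fw; exact: FBw.
    have mEB : measurable (E `&` X n @^-1` B) by exact: measurableI.
    have mFB : measurable (F `&` X n @^-1` B) by exact: measurableI.
    rewrite !measureD// ?ltey_eq ?finP//.
    rewrite setIACA setIid (setIidr FE).
    transitivity (P E * P (X n @^-1` B) - P F * P (X n @^-1` B)).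
      by congr (_ - _).
    by rewrite muleBl ?finP// fin_num_adde_defr ?finP.
  + have mF i : measurable (F i) by have [] := HF i.
    have mU : measurable (\bigcup_i F i) by exact: bigcupT_measurable.
    split => //; rewrite setI_bigcupl.
    have mFB i : measurable (F i `&` X n @^-1` B) by exact: measurableI.
    have cvg1 : P (F i `&` X n @^-1` B) @[i --> \oo] -->
        P (\bigcup_i (F i `&` X n @^-1` B)).
      apply: nondecreasing_cvg_mu => //; first exact: bigcupT_measurable.
      by move=> i j ij; apply/subsetPset; apply: setSI; exact/subsetPset/ndF.
    have cvg2 : P (F i) * P (X n @^-1` B) @[i --> \oo] -->
        P (\bigcup_i F i) * P (X n @^-1` B).
      by apply: cvgeZr; [exact: finP|exact: nondecreasing_cvg_mu].
    apply: cvg_unique cvg1 _ => //; rewrite (_ : (fun _ => _) =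
      (fun i => P (F i) * P (X n @^-1` B)))//.
    by apply/funext => i; have [] := HF i.
- move=> _ [C mC <-]; split.
    by apply: past_measurable; exists C.
  (* Adding the condition on [X n] gives one intersection over [n] and [J]; mutual independence is
     used for this index set and for [J] alone. *)
  pose D i := if i == n then B else C i.
  have mD i : measurable (D i) by rewrite /D; case: ifP.
  pose J := [fset i | i in iota 0 n]%fset.
  have inJ i : (i \in J) = (i < n)%N by rewrite inE /= mem_iota add0n.
  have nJ : n \notin J by rewrite inJ ltnn.
  have JE : \bigcap_(i in [set` J]) (X i @^-1` D i) =
      \bigcap_(i in `I_n) X i @^-1` C i.
    apply/seteqP; split=> w h i /= ni.
      have iJ : i \in J by rewrite inJ.
      by have := h i iJ; rewrite /D ltn_eqF.
    have {}ni : (i < n)%N by rewrite -inJ.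
    by have := h i ni; rewrite /D ltn_eqF.
  have J'E : \bigcap_(i in [set` (n |` J)%fset]) (X i @^-1` D i) =
      (\bigcap_(i in `I_n) X i @^-1` C i) `&` X n @^-1` B.
    rewrite -JE; apply/seteqP; split=> [w h|w [h1 h2] i /=].
      have inU i : i \in J \/ i = n -> (X i @^-1` D i) w.
        move=> iJn; apply: h; rewrite /= in_fset1U.
        by case: iJn => [->|->]; rewrite ?orbT ?eqxx.
      split=> [i /= iJ|]; first by apply: inU; left.
      by have := inU n (or_intror erefl); rewrite /D eqxx.
    rewrite in_fset1U => /predU1P[->|iJ]; last exact: h1.
    by rewrite /D eqxx.
  rewrite -J'E -JE !indep// big_fsetU1//= muleC; congr (_ * _).
  by rewrite /D eqxx.
Qed.

(** [Z] stands for any function of the first n variables. The law of (Z, X n) agrees with the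
    product of its marginals on rectangles, hence everywhere, and Tonelli applies. *)
Lemma integral_independent_past n d1 (T1 : measurableType d1) (Z : T -> T1)
    (f : T1 * T' -> \bar R) :
  measurable_fun setT (Z : g_sigma_algebraType (past n) -> T1) ->
  measurable_fun setT f -> (forall z, 0 <= f z) ->
  \int[P]_w f (Z w, X n w) =
  \int[P]_w \int[distribution P (X n)]_g f (Z w, g).
Proof.
move=> mZ mf f0.
have pastm A : <<s past n >> A -> measurable A.
  by apply: smallest_sub; [exact: sigma_algebra_measurable|exact: past_measurable].
have mZ' : measurable_fun setT Z.
  by move=> _ A mA; rewrite setTI; apply: pastm; rewrite -[_ @^-1` _]setTI; exact: mZ.
have mZX : measurable_fun setT (fun w => (Z w, X n w)).
  exact: measurable_fun_pair.
pose Y : {RV P >-> T1} := HB.pack Z (isMeasurableFun.Build _ _ _ _ Z mZ').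
pose YX : {RV P >-> (T1 * T')%type} :=
  HB.pack (fun w => (Z w, X n w)) (isMeasurableFun.Build _ _ _ _ _ mZX).
have jointE A : measurable A ->
    (distribution P Y \x distribution P (X n)) A = distribution P YX A.
  apply: product_measure_unique => A1 A2 mA1 mA2.
  rewrite -[RHS]independent_past//.
  by rewrite -[_ @^-1` _]setTI; exact: mZ.
transitivity (\int[distribution P YX]_z f z).
  by rewrite ge0_integral_distribution.
transitivity (\int[distribution P Y \x distribution P (X n)]_z f z).
  by apply: eq_measure_integral => A mA _; exact/esym/jointE.
rewrite fubini_tonelli1// ge0_integral_distribution//.
- exact: measurable_fun_fubini_tonelli_F.
- by move=> x; apply: integral_ge0.
Qed.

End independence.

(** * Limits of bounds, full events, and laws determined by rays *)

Section probability_lemmas.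
Set Implicit Arguments.
Unset Strict Implicit.
Context {R : realType}.
Local Open Scope ereal_scope.

Lemma lee_add_cvg0 (x y : \bar R) (u : nat -> \bar R) : y \is a fin_num ->
  u n @[n --> \oo] --> 0 -> (forall n, x <= y + u n) -> x <= y.
Proof.
move=> yfin u0 xyu.
have h : y + u n @[n --> \oo] --> y.
  rewrite -[X in _ --> X]adde0; apply: cvgeD => //; last exact: cvg_cst.
  by rewrite fin_num_adde_defr.
by rewrite -(cvg_lim _ h)//; apply: lime_ge; [exact: cvgP h|exact: nearW].
Qed.

Lemma measure_setI_full d (T : measurableType d)
    (m : {measure set T -> \bar R}) (A B : set T) :
  measurable A -> measurable B -> m (~` B) = 0 -> m (A `&` B) = m A.
Proof.
move=> mA mB B0; rewrite [RHS](measureDI m mA mB).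
rewrite [X in X + _](_ : _ = 0) ?add0e//.
apply: (subset_measure0 _ _ _ B0); [exact: measurableD|exact: measurableC|].
by move=> x [].
Qed.

Lemma measurable_lt_cst d (T : measurableType d) (f : T -> R) (e : R) :
  measurable_fun setT f -> measurable [set x | (e < f x)%R].
Proof.
move=> mf; have := measurable_fun_ltr (@measurable_cst _ _ _ _ setT e) mf.
by move=> /(_ measurableT [set true] I); rewrite setTI.
Qed.

(** The intervals ]a, b] are differences of rays, and finiteness allows the subtraction; they form a
    generating pi-system. *)
Lemma finite_measure_rays_unique (m1 m2 : {measure set R -> \bar R}) :
  m1 setT < +oo ->
  (forall t : R, m1 `]-oo, t]%classic = m2 `]-oo, t]%classic) ->
  forall A, measurable A -> m1 A = m2 A.
Proof.
move=> m1T m12.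
have m1y A : measurable A -> m1 A < +oo.
  by move=> mA; apply: le_lt_trans m1T; rewrite le_measure ?inE.
have oc (a b : R) : m1 `]a, b]%classic = m2 `]a, b]%classic.
  have [ba|ab] := leP b a.
    by rewrite set_itv_ge ?measure0// bnd_simp -leNgt.
  have -> : `]a, b]%classic = `]-oo, b] `\` `]-oo, a] :> set R.
    apply/seteqP; split=> x /=; rewrite !in_itv/=.
      by move=> /andP[ax ->]; split => //; apply/negP; rewrite -ltNge.
    by move=> [-> /negP]; rewrite -ltNge => ->.
  have sub : (`]-oo, a] : set R) `<=` `]-oo, b].
    by move=> x /=; rewrite !in_itv/= => /le_trans; apply; exact: ltW.
  have m2y (t : R) : m2 `]-oo, t]%classic < +oo by rewrite -m12 m1y.
  rewrite !measureD// ?m1y ?m2y//.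
  by rewrite (setIidr sub); congr (_ - _); apply: m12.
pose g (k : nat) := `](- k%:R)%R, k%:R]%classic : set R.
move=> A mA; apply: (measure_unique (@ocitv R) g) => //.
- exact: ocitvI.
- by move=> k; exact: is_ocitv.
- apply/seteqP; split=> // x _; exists (Num.truncn `|x|).+1 => //.
  have := truncnS_gt `|x|%R; rewrite ltr_norml => /andP[x1 /ltW x2].
  by rewrite /g /= in_itv/= x1 x2.
- by move=> _ [[a b]] _ <-; exact: oc.
- by move=> k; apply: m1y; exact: measurable_itv.
Qed.

End probability_lemmas.

(** * Perpetuities with an invariant law *)

Section perpetuity_law.
Set Implicit Arguments.
Unset Strict Implicit.
Context d (T : measurableType d) {R : realType} (P : probability T R).
(** Nothing in this section is specific to GIG laws: the sequence is i.i.d. and almost surely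
    positive, and [nu] is a law on [0, +oo[ invariant under x -> 1/g + x/g^2. *)
Variables (gamma : nat -> {RV P >-> R}) (nu : probability R R).
Hypothesis gamma_indep : mutually_independent P gamma.
Hypothesis gamma_id : forall n A, measurable A ->
  distribution P (gamma n) A = distribution P (gamma 0) A.
Hypothesis gamma_gt0 : distribution P (gamma 0) `]-oo, 0]%classic = 0%E.
Hypothesis nu_ge0 : nu `]-oo, 0[%classic = 0%E.
Hypothesis nu_invariant : forall f : R -> \bar R,
  measurable_fun setT f -> (forall x, 0 <= f x)%E ->
  (\int[distribution P (gamma 0)]_g \int[nu]_x f (g^-1 + g^-1 ^+ 2 * x)%R =
   \int[nu]_x f x)%E.

Let S n w := series (perpetuity_term gamma w) n.
Let Q n w := (\prod_(i < n) (gamma i w)^-1) ^+ 2.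

Let S0 w : S 0 w = 0. Proof. by rewrite /S /series/= big_geq. Qed.

Let SS n w : S n.+1 w = S n w + (gamma n w)^-1 * Q n w.
Proof. by rewrite /S /series/= big_nat_recr. Qed.

Let Q0 w : Q 0 w = 1. Proof. by rewrite /Q big_ord0 expr1n. Qed.

Let QS n w : Q n.+1 w = Q n w * (gamma n w)^-1 ^+ 2.
Proof. by rewrite /Q big_ord_recr/= exprMn. Qed.

Let Q_ge0 n w : 0 <= Q n w. Proof. exact: sqr_ge0. Qed.

Let measurable_SQ_past n :
  measurable_fun setT (S n : g_sigma_algebraType (past gamma n) -> R) /\
  measurable_fun setT (Q n : g_sigma_algebraType (past gamma n) -> R).
Proof.
(* The sigma-algebra stays that of stage n while the induction runs over m. *)
suff h m : (m <= n)%N ->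
  measurable_fun setT (S m : g_sigma_algebraType (past gamma n) -> R) /\
  measurable_fun setT (Q m : g_sigma_algebraType (past gamma n) -> R).
  exact: h.
elim: m => [_|m ih mn].
  by split; [rewrite (funext S0)|rewrite (funext Q0)]; exact: measurable_cst.
have [mS mQ] := ih (ltnW mn).
have mV : measurable_fun setT
    ((fun w => (gamma m w)^-1) : g_sigma_algebraType (past gamma n) -> R).
  apply: (measurableT_comp measurable_invr); exact: measurable_past.
split.
  rewrite (funext (SS m)).
  by apply: measurable_funD => //; exact: measurable_funM.
rewrite (funext (QS m)).
by apply: measurable_funM => //; exact: measurable_funX.
Qed.

Let measurable_past_fun n d1 (T1 : measurableType d1) (Z : T -> T1) :
  measurable_fun setT (Z : g_sigma_algebraType (past gamma n) -> T1) ->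
  measurable_fun setT Z.
Proof.
move=> mZ _ A mA; rewrite setTI.
have := mZ measurableT A mA; rewrite setTI.
have : <<s past gamma n >> `<=` measurable by apply: smallest_sub;
  [exact: sigma_algebra_measurable|exact: past_measurable].
exact.
Qed.

Let mS n : measurable_fun setT (S n).
Proof. by have [/measurable_past_fun] := measurable_SQ_past n. Qed.

Let mQ n : measurable_fun setT (Q n).
Proof. by have [_ /measurable_past_fun] := measurable_SQ_past n. Qed.

Local Open Scope ereal_scope.

(** The newest variable acts innermost: S_(n+1) + Q_(n+1) x = S_n + Q_n (1/gamma_n + x/gamma_n^2).
    As gamma_n is independent of (S_n, Q_n), invariance applied to x -> f(S_n + Q_n x) removes
    it. *)
Lemma perpetuity_step_law n (f : R -> \bar R) :
  measurable_fun setT f -> (forall x, 0 <= f x) ->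
  \int[P]_w \int[nu]_x f (S n w + Q n w * x)%R = \int[nu]_x f x.
Proof.
move=> mf f0; elim: n => [|n ih].
  under eq_integral.
    move=> w _; under eq_integral do rewrite S0 Q0 add0r mul1r.
    over.
  by rewrite integral_cst// -[RHS]mule1; congr (_ * _); exact: probability_setT.
pose F (t : R * R * R * R) : \bar R :=
  f (t.1.1.1 + t.1.1.2 * (t.1.2^-1 + t.1.2^-1 ^+ 2 * t.2))%R.
have mF : measurable_fun setT F.
  have mV : measurable_fun setT (fun t : R * R * R * R => t.1.2^-1%R).
    by apply: (measurableT_comp measurable_invr); exact: measurableT_comp.
  apply: measurableT_comp => //; apply: measurable_funD.
    by apply: measurableT_comp => //; exact: measurableT_comp.
  apply: measurable_funM.
    by apply: measurableT_comp => //; exact: measurableT_comp.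
  by apply: measurable_funD => //; apply: measurable_funM => //; exact: measurable_funX.
pose h (t : R * R * R) : \bar R := \int[nu]_x F (t, x).
have mh : measurable_fun setT h.
  exact: (measurable_fun_fubini_tonelli_F (m2 := nu) F mF (fun t => f0 _)).
have h0 t : 0 <= h t by apply: integral_ge0 => x _; exact: f0.
rewrite -ih; transitivity (\int[P]_w h (S n w, Q n w, gamma n w)).
  apply: eq_integral => w _; apply: eq_integral => x _; congr f => /=.
  by rewrite SS QS; ring.
rewrite (integral_independent_past gamma_indep (Z := fun w => (S n w, Q n w)))//.
  apply: eq_integral => w _.
  rewrite (eq_measure_integral (distribution P (gamma 0))); last first.
    by move=> A mA _; exact: gamma_id.
  rewrite -(nu_invariant (f := fun x => f (S n w + Q n w * x)%R))//.
  by apply: measurableT_comp => //; apply: measurable_funD => //; exact: measurable_funM.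
by have [mSn mQn] := measurable_SQ_past n; exact: measurable_fun_pair.
Qed.

Let Pos := [set w | forall n, (0 < gamma n w)%R].
(** A substitute for the event that the limit is at most t, meaningful before convergence is
    known. *)
Let V t := [set w | forall n, (S n w <= t)%R].
Let le_S n t := [set w | (S n w <= t)%R].

Let mPos : measurable Pos.
Proof.
have -> : Pos = \bigcap_n (gamma n @^-1` `]0%R, +oo[).
  apply/seteqP; split=> w h n; first by move=> _; rewrite /= in_itv/= h.
  by have := h n I; rewrite /= in_itv/= andbT.
by apply: bigcapT_measurable => n; exact: measurable_funPTI.
Qed.

Let PPos : P (~` Pos) = 0.
Proof.
apply: measure_negligible; first exact: measurableC.
have -> : ~` Pos = \bigcup_n (gamma n @^-1` `]-oo, 0%R]).
  apply/seteqP; split=> w.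
    by move=> /existsNP[n /negP]; rewrite -leNgt => ?; exists n.
  by move=> [n _ /=]; rewrite in_itv/= leNgt => /negP h /(_ n).
apply: negligible_bigcup => n; apply/negligibleP; first exact: measurable_funPTI.
by have := gamma_id n (measurable_itv `]-oo, 0%R]); rewrite gamma_gt0.
Qed.

Let mle_S n t : measurable (le_S n t).
Proof.
have := measurable_fun_ler (mS n) (@measurable_cst _ _ _ _ setT t).
by move=> /(_ measurableT [set true] I); rewrite setTI.
Qed.

Let mV t : measurable (V t).
Proof.
have -> : V t = \bigcap_n le_S n t.
  by apply/seteqP; split=> w h n; [move=> _; exact: h|exact: (h n I)].
by apply: bigcapT_measurable => n; exact: mle_S.
Qed.

Let S_nd w : Pos w -> nondecreasing_seq (S ^~ w).
Proof.
move=> w0; apply/nondecreasing_seqP => n; rewrite SS lerDl.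
by rewrite mulr_ge0// invr_ge0 ltW.
Qed.

Let measurable_le_affine n t w :
  measurable [set x | (S n w + Q n w * x <= t)%R].
Proof.
have := @measurable_fun_ler _ _ _ setT (fun x => S n w + Q n w * x)%R (cst t).
move=> /(_ _ _ measurableT [set true] I); rewrite setTI; apply.
  by apply: measurable_funD => //; exact: measurable_funM.
exact: measurable_cst.
Qed.

Let integral_ray n t w :
  \int[nu]_x (\1_`]-oo, t]%classic (S n w + Q n w * x)%R)%:E =
  nu [set x | (S n w + Q n w * x <= t)%R].
Proof.
by rewrite -[X in _ = nu X]setIT -integral_indic//.
Qed.

Let indic_ray_law n t :
  \int[P]_w nu [set x | (S n w + Q n w * x <= t)%R] = nu `]-oo, t]%classic.
Proof.
under eq_integral do rewrite -integral_ray.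
rewrite (perpetuity_step_law n 
  (f := fun x => (\1_(`]-oo, t]%classic : set R) x)%:E)).
- by rewrite integral_indic// setIT.
- by apply/measurable_EFinP; exact: measurable_indic.
- by move=> x; rewrite lee_fin.
Qed.

Let measurable_ray n t :
  measurable_fun setT (fun w => nu [set x | (S n w + Q n w * x <= t)%R]).
Proof.
under eq_fun do rewrite -integral_ray.
pose F (z : T * R) : \bar R := (\1_`]-oo, t]%classic (S n z.1 + Q n z.1 * z.2)%R)%:E.
have mF : measurable_fun setT F.
  apply/measurable_EFinP; apply: (measurableT_comp (measurable_indic _)) => //.
  apply: measurable_funD; first exact: (measurableT_comp (mS n)).
  by apply: measurable_funM => //; exact: (measurableT_comp (mQ n)).
have F0 z : 0 <= F z by rewrite lee_fin.
exact: (measurable_fun_fubini_tonelli_F (m2 := nu) F mF F0).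
Qed.

Let ray_le_S n t : nu `]-oo, t]%classic <= P (le_S n t).
Proof.
rewrite -(indic_ray_law n) -[X in _ <= P X]setIT -integral_indic//.
apply: ge0_le_integral => //.
- exact/measurable_EFinP/measurable_indic.
move=> w _; have [St|tS] := leP (S n w) t.
  by rewrite indicE mem_set//; exact: probability_le1.
rewrite indicE memNset; last by apply/negP; rewrite -ltNge.
(* When S_n > t, every x with S_n + Q_n x <= t is negative, so these x form a [nu]-null set. *)
rewrite le_eqVlt; apply/orP; left; apply/eqP.
apply: (subset_measure0 (measurable_le_affine n t w) _ _ nu_ge0) => //.
move=> x /= h; rewrite in_itv/= ltNge; apply/negP => x0.
by have := lt_le_trans tS (le_trans _ h); rewrite ltxx lerDl mulr_ge0// => /(_ isT).
Qed.

Let ray_le_V t : nu `]-oo, t]%classic <= P (Pos `&` V t).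
Proof.
have VE : Pos `&` V t = \bigcap_n (Pos `&` le_S n t).
  apply/seteqP; split=> [w [w0 wt] n _|w h]; first by split => //; exact: wt.
  by split=> [|n]; [have [] := h 0%N I|have [] := h n I].
have cvgV : P (Pos `&` le_S n t) @[n --> \oo] --> P (Pos `&` V t).
  rewrite VE; apply: nonincreasing_cvg_mu.
  - by rewrite (le_lt_trans (probability_le1 _ _)) ?ltry//; exact: measurableI.
  - by move=> n; exact: measurableI.
  - by apply: bigcapT_measurable => n; exact: measurableI.
  - move=> n m nm; apply/subsetPset => w [w0 wt]; split => //.
    exact: le_trans (S_nd w0 nm) wt.
rewrite -(cvg_lim _ cvgV)//; apply: lime_ge; first exact: cvgP cvgV.
apply: nearW => n; rewrite (le_trans (ray_le_S n t))// setIC.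
by rewrite (measure_setI_full (m := P)).
Qed.

Let Good := \bigcup_k (Pos `&` V k%:R).

Let mGood : measurable Good.
Proof. by apply: bigcupT_measurable => k; exact: measurableI. Qed.

(** [Good] contains the events [Pos] and [V k] together, of probability at least nu ]-oo, k], which
    tends to 1. *)
Let PGood : P (~` Good) = 0.
Proof.
rewrite probability_setC//; suff -> : P Good = 1 by rewrite subee.
apply/eqP; rewrite eq_le probability_le1//=.
have cvg1 : nu `]-oo, k%:R]%classic @[k --> \oo] --> (1 : \bar R).
  have UT : \bigcup_k `]-oo, k%:R]%classic = [set: R].
    apply/seteqP; split=> // x _; exists (Num.truncn x).+1 => //=.
    by rewrite in_itv/= ltW// truncnS_gt.
  rewrite -(probability_setT nu) -UT; apply: nondecreasing_cvg_mu => //.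
    by rewrite UT.
  move=> n m nm; apply/subsetPset => x /=; rewrite !in_itv/= => /le_trans.
  by apply; rewrite ler_nat.
rewrite -(cvg_lim _ cvg1)//; apply: lime_le; first exact: cvgP cvg1.
apply: nearW => k; rewrite (le_trans (ray_le_V _))// le_measure ?inE//.
  exact: measurableI.
by move=> w wk; exists k.
Qed.

Let Good_cvg w : Good w -> cvgn (S ^~ w).
Proof.
move=> [k _ [w0 wk]]; apply: nondecreasing_is_cvgn; first exact: S_nd.
by exists k%:R => _ [n _ <-]; exact: wk.
Qed.

Lemma perpetuity_ae_cvg : {ae P, forall w, cvgn (series (perpetuity_term gamma w))}.
Proof.
exists (~` Good); split => //; first exact: measurableC.
by move=> w /= ncvg wG; apply: ncvg; exact: Good_cvg.
Qed.

Let large_term n e := [set w | (e < (gamma n w)^-1 * Q n w)%R].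

Let mlarge n e : measurable (large_term n e).
Proof.
apply: measurable_lt_cst; apply: measurable_funM => //.
exact: (measurableT_comp measurable_invr).
Qed.

Let large_term_cvg0 e : (0 < e)%R -> P (large_term n e) @[n --> \oo] --> 0.
Proof.
move=> e0.
(* Restricting to the full event [Good] makes the indicators tend to 0 at every point, so dominated
   convergence applies. *)
have -> : (fun n => P (large_term n e)) =
    (fun n => \int[P]_(w in Good) (\1_(large_term n e) w)%:E).
  by apply/funext => n; rewrite integral_indic// (measure_setI_full (m := P)).
rewrite -(integral0 P Good).
apply: (@dominated_cvg _ _ _ _ _ _ _ _ (cst 1)) => //.
- by move=> n; exact/measurable_EFinP/measurable_indic.
- move=> w wG; apply: cvg_near_cst.
  have := cvg_series_cvg_0 (Good_cvg wG).
  move=> /cvgrPdist_lt /(_ _ e0); apply: filterS => n.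
  rewrite sub0r normrN => /(le_lt_trans (ler_norm _)) ltw.
  rewrite indicE memNset// => /lt_trans /(_ ltw).
  by rewrite ltxx.
- exact: finite_measure_integrable_cst.
- by move=> n w _; rewrite gee0_abs ?lee_fin.
Qed.

(** Otherwise 1/gamma_0 would almost surely exceed no 1/(k+1), which forces gamma_0 <= 0 almost
    surely. *)
Let small_gamma : exists2 c : R, (0 < c)%R &
  distribution P (gamma 0) [set g | (c < g^-1)%R] != 0.
Proof.
apply: contrapT => h.
have mB (c : R) : measurable [set g : R | (c < g^-1)%R].
  exact: (measurable_lt_cst c (@measurable_invr R)).
have B0 k : distribution P (gamma 0) [set g | (k.+1%:R^-1 < g^-1)%R] = 0.
  apply/eqP; apply: contrapT => /negP hk; apply: h.
  by exists (k.+1%:R^-1)%R.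
have U0 : distribution P (gamma 0) (\bigcup_k [set g | (k.+1%:R^-1 < g^-1)%R]) = 0.
  apply: measure_negligible; first by apply: bigcupT_measurable => k; exact: mB.
  by apply: negligible_bigcup => k; apply/negligibleP; [exact: mB|exact: B0].
have UE : \bigcup_k [set g : R | (k.+1%:R^-1 < g^-1)%R] = `]0%R, +oo[%classic.
  apply/seteqP; split=> g /=.
    move=> [k _ /=] kg; rewrite in_itv/= andbT -invr_gt0.
    by rewrite (lt_trans _ kg)// invr_gt0.
  rewrite in_itv/= andbT => g0; exists (Num.truncn g) => //=.
  by rewrite ltf_pV2 ?posrE// truncnS_gt.
have h1 : distribution P (gamma 0) setT = distribution P (gamma 0) `]-oo, 0%R] +
    distribution P (gamma 0) `]0%R, +oo[.
  have -> : setT = `]-oo, 0%R]%classic `|` `]0%R, +oo[%classic :> set R.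
    by rewrite -setCitvl setUv.
  by rewrite measureU// -setCitvl setICr.
have : distribution P (gamma 0) setT = 1 by exact: probability_setT.
rewrite h1 gamma_gt0 -UE U0 adde0 => /esym/eqP.
by rewrite onee_eq0.
Qed.

(* Q n is independent of gamma n, and Q n / gamma n is the n-th term of a series
   that converges almost surely. *)
Let Q_cvg0 e : (0 < e)%R -> P [set w | (e < Q n w)%R] @[n --> \oo] --> 0.
Proof.
move=> e0; have [c c0 p0] := small_gamma.
set B := [set g | (c < g^-1)%R] in p0; set p := distribution _ _ _ in p0.
have mB : measurable B by exact: (measurable_lt_cst c (@measurable_invr R)).
have p_ge0 : 0 <= p by exact: measure_ge0.
have pfin : p \is a fin_num by exact: fin_num_measure.
have mQe n : <<s past gamma n >> [set w | (e < Q n w)%R].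
  by have [_ /(measurable_lt_cst e)] := measurable_SQ_past n.
have mQe' n : measurable [set w | (e < Q n w)%R].
  exact: (measurable_lt_cst e (mQ n)).
have PQp n : P [set w | (e < Q n w)%R] * p =
    P ([set w | (e < Q n w)%R] `&` gamma n @^-1` B).
  rewrite (independent_past gamma_indep)//; congr (_ * _).
  by rewrite /p -(gamma_id n mB).
(* If Q_n > e and 1/gamma_n > c, the n-th term exceeds c e. The factor p > 0 does not depend on n,
   so it can be divided out. *)
have le_large n : P [set w | (e < Q n w)%R] * p <= P (large_term n (c * e)%R).
  rewrite PQp le_measure ?inE//.
    by apply: measurableI => //; exact: measurable_funPTI.
  move=> w [/= eQ cg]; rewrite /large_term/=.
  by apply: ltr_pM => //; exact: ltW.
have cvgp : P [set w | (e < Q n w)%R] * p @[n --> \oo] --> 0.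
  apply: (@squeeze_cvge _ _ _ _ (cst 0) _ (fun n => P (large_term n (c * e)%R))).
  - by apply: nearW => n; rewrite /cst/= mule_ge0 ?measure_ge0 ?le_large.
  - exact: cvg_cst.
  - by apply: large_term_cvg0; rewrite mulr_gt0.
have E n : P [set w | (e < Q n w)%R] =
    P [set w | (e < Q n w)%R] * p * ((fine p)^-1)%:E.
  by rewrite -muleA -{1}(fineK pfin) -EFinM divff ?mule1// fine_eq0.
rewrite (funext E) -(mul0e ((fine p)^-1)%:E).
exact: cvgeZr.
Qed.

(** If S_n <= t, then S_n + Q_n X <= t + e unless X > k+1 or Q_n > e/(k+1). For fixed k the last
    event disappears as n grows; then k tends to infinity. *)
Let PV_le_eps t e : (0 < e)%R -> P (Pos `&` V t) <= nu `]-oo, (t + e)%R]%classic.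
Proof.
move=> e0.
pose tail (k : nat) := `]k.+1%:R, +oo[%classic : set R.
have mtail k : measurable (tail k) by exact: measurable_itv.
have tail_cvg0 : nu (tail k) @[k --> \oo] --> 0.
  have T0 : \bigcap_k tail k = set0.
    apply/seteqP; split=> // x /(_ (Num.truncn x) I).
    by rewrite /tail/= in_itv/= andbT ltNge ltW// truncnS_gt.
  rewrite -(measure0 nu) -T0; apply: nonincreasing_cvg_mu => //.
  - by rewrite (le_lt_trans (probability_le1 _ _)) ?ltry//; exact: measurable_itv.
  - by rewrite T0.
  - move=> n m nm; apply/subsetPset => x; rewrite /tail/= !in_itv/= !andbT.
    by apply: le_lt_trans; rewrite ler_nat.
apply: (lee_add_cvg0 (u := fun k => nu (tail k))) => // [|k].
  by rewrite fin_num_measure.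
pose del : R := (e / k.+1%:R)%R.
have del0 : (0 < del)%R by rewrite divr_gt0.
apply: (lee_add_cvg0 (u := fun n => P [set w | (del < Q n w)%R])).
- by rewrite fin_numD !fin_num_measure//; exact: mtail.
- exact: Q_cvg0.
move=> n.
have mQd : measurable [set w | (del < Q n w)%R].
  exact: (measurable_lt_cst del (mQ n)).
apply: (@le_trans _ _ (P (le_S n t))).
  rewrite le_measure ?inE//; first exact: measurableI.
  by move=> w [_ wt]; exact: wt.
rewrite -(indic_ray_law n (t + e)%R).
have -> : nu (tail k) = \int[P]_w nu (tail k).
  by rewrite integral_cst// -[LHS]mule1; congr (_ * _); exact/esym/probability_setT.
rewrite -[X in _ <= _ + P X]setIT -integral_indic//.
rewrite -[X in P X <= _]setIT -integral_indic//.
rewrite -ge0_integralD//.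
have mi A : measurable A -> measurable_fun setT (fun w : T => (\1_A w)%:E : \bar R).
  by move=> mA; apply/measurable_EFinP; exact: measurable_indic.
rewrite -ge0_integralD//; last 3 first.
- by move=> w _; rewrite adde_ge0.
- by apply: emeasurable_funD => //; exact: measurable_ray.
- exact: mi.
apply: ge0_le_integral => //.
- exact: mi.
- apply: emeasurable_funD; last exact: mi.
  by apply: emeasurable_funD => //; exact: measurable_ray.
move=> w _; have [Sw|Sw] := leP (S n w) t; last first.
  rewrite [X in X%:E <= _]indicE memNset; last by apply/negP; rewrite -ltNge.
  by rewrite !adde_ge0// lee_fin.
rewrite [X in X%:E <= _]indicE mem_set//=.
have [wd|dw] := leP (Q n w) del; last first.
  by rewrite [X in _ <= _ + X%:E]indicE mem_set//= leeDr// adde_ge0.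
(* With w fixed and Q_n <= [del], the two sets of x cover the line, so their measures add up to at
   least 1. *)
apply: (@le_trans _ _ (nu [set x | (S n w + Q n w * x <= t + e)%R] + nu (tail k))).
  rewrite -(probability_setT nu).
  have mU := measurable_le_affine n (t + e)%R w.
  apply: le_trans (measureU2 _ mU (mtail k)).
  rewrite le_measure ?inE//; first exact: measurableU.
  move=> x _; have [xk|kx] := leP x k.+1%:R; last first.
    by right; rewrite /tail/= in_itv/= kx.
  left => /=; rewrite lerD// (le_trans (y := (Q n w * k.+1%:R)%R))//.
    by rewrite ler_wpM2l.
  by rewrite -ler_pdivlMr.
by rewrite leeDl// lee_fin.
Qed.

(** Right continuity of the distribution function of [nu]. *)
Let PV_le t : P (Pos `&` V t) <= nu `]-oo, t]%classic.
Proof.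
have cvg1 : nu `]-oo, (t + k.+1%:R^-1)%R]%classic @[k --> \oo] -->
    nu `]-oo, t]%classic.
  rewrite (itvNycEbigcap false); apply: nonincreasing_cvg_mu => //.
  - by rewrite (le_lt_trans (probability_le1 _ _)) ?ltry.
  - exact: bigcapT_measurable.
  - move=> n m nm; apply/subsetPset => x /=; rewrite !in_itv/= => /le_trans.
    by apply; rewrite lerD2l lef_pV2 ?posrE// ler_nat.
rewrite -(cvg_lim _ cvg1)//; apply: lime_ge; first exact: cvgP cvg1.
by apply: nearW => k; apply: PV_le_eps; rewrite invr_gt0.
Qed.

Theorem perpetuity_invariant_law (A : set R) : measurable A ->
  distribution P (perpetuity gamma) A = nu A.
Proof.
apply: finite_measure_rays_unique.
  by rewrite (le_lt_trans (probability_le1 _ _)) ?ltry.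
move=> t; transitivity (P (Pos `&` V t)); last first.
  by apply/eqP; rewrite eq_le PV_le ray_le_V.
have mN : measurable (perpetuity gamma @^-1` `]-oo, t]).
  exact: measurable_funPTI.
(* Outside [Good] the perpetuity may be the default value of [limn], so both events are compared
   inside [Good]. *)
transitivity (P (perpetuity gamma @^-1` `]-oo, t] `&` Good)).
  exact/esym/(measure_setI_full mN mGood PGood).
rewrite -(measure_setI_full (m := P) (A := Pos `&` V t) _ mGood PGood)//;
  last exact: measurableI.
congr (P _); apply/seteqP; split=> w [h wG]; split => //;
  case: (wG) => k _ [w0 _].
  have Nt : (perpetuity gamma w <= t)%R by move: h; rewrite /= in_itv.
  split => // n; apply: le_trans Nt.
  exact: (nondecreasing_cvgn_le (S_nd w0) (Good_cvg wG)).
have [_ wt] := h; rewrite /= in_itv/=; apply: limr_le; first exact: Good_cvg.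
exact: nearW.
Qed.

End perpetuity_law.

(** * Application to the GIG and inverse-gamma laws *)

Lemma ex_density_probability {R : realType} (p : R -> R) :
  measurable_fun setT p -> (forall x, 0 <= p x) ->
  (\int[lebesgue_measure]_x (p x)%:E = 1)%E ->
  exists nu : probability R R,
    forall A, (nu A = \int[lebesgue_measure]_(x in A) (p x)%:E)%E.
Proof.
move=> mp p0 p1; pose f (A : set R) := (\int[lebesgue_measure]_(x in A) (p x)%:E)%E.
have mf0 : f set0 = 0%E by rewrite /f integral_set0.
have f_ge0 A : (0 <= f A)%E by apply: integral_ge0 => x _; rewrite lee_fin.
have f_sigma : semi_sigma_additive f.
  move=> F mF tF mUF; rewrite /f; apply: cvg_toP.
    apply: ereal_nondecreasing_is_cvgn => i j ij.
    by apply: lee_sum_nneg_natr => // k _ _; exact: f_ge0.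
  rewrite ge0_integral_bigcup//.
  - exact/measurable_funTS/measurable_EFinP.
  - by move=> x _; rewrite lee_fin.
pose mm := isMeasure.Build _ R R f mf0 f_ge0 f_sigma.
pose fm : {measure set R -> \bar R} := HB.pack f mm.
pose fp : probability R R := HB.pack f mm (Measure_isProbability.Build _ _ _ fm p1).
by exists fp.
Qed.

(** Almost sure convergence is stated beside the law because [perpetuity] has a default value where
    the series diverges. *)
Theorem theorem5p7 (R : realType) (d : measure_display) (T : measurableType d)
    (P : probability T R) (lambda a : R) (gamma : nat -> {RV P >-> R})
    (lambda_gt0 : 0 < lambda) (a_gt0 : 0 < a)
    (gamma_indep : mutually_independent P gamma)
    (gamma_law : forall n, has_law P (gamma n) (gig_prob lambda a)) :
  {ae P, forall w, cvgn (series (perpetuity_term gamma w))} /\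
  has_law P (perpetuity gamma) (inv_gamma_prob lambda a).
Proof.
(* The total mass of the law of [gamma 0]: the source of all normalizations. *)
have mass : (\int[lebesgue_measure]_x (gig_pdf lambda a x)%:E = 1)%E.
  rewrite -[LHS](gamma_law 0 _ measurableT).
  exact: (probability_setT (distribution P (gamma 0))).
(* [inv_gamma_prob] is a bare set function, while the invariance argument works with a
   [probability]. *)
have [nu nuE] : exists nu : probability R R, forall A,
    (nu A = \int[lebesgue_measure]_(x in A) (inv_gamma_pdf lambda a x)%:E)%E.
  apply: ex_density_probability.
  - exact: measurable_inv_gamma_pdf.
  - exact: inv_gamma_pdf_ge0.
  - exact: integral_inv_gamma_pdf.
have gamma_id n A : measurable A ->
    distribution P (gamma n) A = distribution P (gamma 0) A.
  by move=> mA; rewrite !gamma_law.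
have gamma_gt0 : distribution P (gamma 0) `]-oo, 0]%classic = 0%E.
  rewrite gamma_law// /gig_prob integral0_eq// => x /=; rewrite in_itv/= => x0.
  by rewrite gig_pdfE// gig_kernel_le0// mulr0.
have nu_ge0 : nu `]-oo, 0[%classic = 0%E.
  rewrite nuE integral0_eq// => x /=; rewrite in_itv/= => x0.
  by rewrite inv_gamma_pdfE// gig_kernel_le0 ?mulr0// ltW.
have nu_inv (f : R -> \bar R) : measurable_fun setT f -> (forall x, 0 <= f x)%E ->
    (\int[distribution P (gamma 0%N)]_g \int[nu]_x f (g^-1 + g^-1 ^+ 2 * x)%R =
     \int[nu]_x f x)%E.
  move=> mf f0.
  pose F (z : R * R) := f (z.1^-1 + z.1^-1 ^+ 2 * z.2).
  have mF : measurable_fun setT F.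
    have mV : measurable_fun setT (fun z : R * R => z.1^-1).
      exact: (measurableT_comp measurable_invr).
    apply: measurableT_comp => //; apply: measurable_funD => //.
    by apply: measurable_funM => //; exact: measurable_funX.
  have mFg g : measurable_fun setT (fun x => F (g, x)).
    by apply: (measurableT_comp mF); exact: measurable_fun_pair.
  rewrite (integral_density (p := gig_pdf lambda a)); first last.
  - by move=> g; exact: integral_ge0.
  - exact: (measurable_fun_fubini_tonelli_F (m2 := nu) F mF (fun z => f0 _)).
  - exact: gamma_law.
  - exact: gig_pdf_ge0.
  - exact: measurable_gig_pdf.
  have nu_density (h : R -> \bar R) : measurable_fun setT h -> (forall x, 0 <= h x)%E ->
      (\int[nu]_x h x =
       \int[lebesgue_measure]_x (h x * (inv_gamma_pdf lambda a x)%:E))%E.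
    move=> mh h0; apply: integral_density => [| |A mA| |].
    - exact: measurable_inv_gamma_pdf.
    - exact: inv_gamma_pdf_ge0.
    - exact: nuE.
    - exact: mh.
    - exact: h0.
  rewrite [RHS]nu_density//.
  rewrite -(inv_gamma_invariant mass mf f0).
  apply: eq_integral => g _; congr (_ * _)%E.
  by rewrite nu_density//; exact: (mFg g).
split; first exact: perpetuity_ae_cvg gamma_indep gamma_id gamma_gt0 nu_ge0 nu_inv.
move=> A mA; transitivity (nu A); last exact: nuE.
exact: (perpetuity_invariant_law gamma_indep gamma_id gamma_gt0 nu_ge0 nu_inv).
Qed.
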